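(* Let $C\ge1$ be an integer, $\lambda>0$, $\tau>0$, $\beta\ge0$, and consider the queueing model and the linear program (Q) described in the context. Suppose the optimal solution $t=(t_0,t_1)$ of (Q) satisfies $t_0\ne\mathbf 0$. Then there exists an optimal signaling scheme with signals $S=\{\mathsf{Join}_1,\dots,\mathsf{Join}_J,\mathsf{Leave}\}$ for some $J\le|\Omega|$ such that joining the queue is optimal under each signal $\mathsf{Join}_j$ and leaving is optimal under $\mathsf{Leave}$. Furthermore: 1. For each $j\le J$, a customer's utility upon receiving $\mathsf{Join}_j$ is zero: $\hat\rho(\mu_j)=0$, where $\mu_j$ is the belief induced by $\mathsf{Join}_j$. 2. For each $j\le J$, the belief $\mu_j$ either puts all its weight on a state $\omega^j\in K_1\cap K_0$ (in which case set $\omega_0^j=\omega_1^j=\omega^j$), or there are two states $\omega_0^j\in L_0$ and $\omega_1^j\in K_1$ such that $\mu_j$ puts positive weight only on the states $\omega_0^j$ and $\omega_1^j$. These states form a sandwich structure: $$\omega_1^1\le\omega_1^2\le\cdots\le\omega_1^J\le\omega_0^J\le\omega_0^{J-1}\le\cdots\le\omega_0^1 .$$ 3. For each $2\le j\le J$, $\mathbf E[X\mid\mathsf{Join}_{j-1}]\le\mathbf E[X\mid\mathsf{Join}_j]$ and $\mathrm{Var}(X\mid\mathsf{Join}_{j-1})\ge\mathrm{Var}(X\mid\mathsf{Join}_j)$, where these denote the mean and variance of $X$ under the beliefs $\mu_{j-1},\mu_j$.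
   Context: Model. An unobservable $M/M/1/C$ FIFO queue has Poisson arrivals of rate $\lambda$, unit-mean exponential service times and capacity $C$. Each arriving customer who finds fewer than $C$ customers chooses to join ($a=1$) or leave ($a=0$). The state space is $\Omega=\{0,1,\dots,C-1\}$ (queue length seen on arrival), with its usual order. $\Delta(\Omega)\subset\mathbb R^\Omega$ is the simplex, $e_n$ the point mass at $n$. Given state $n$, the waiting time $X$ is a sum of $n+1$ independent unit-mean exponentials; under belief $\mu\in\Delta(\Omega)$, $X$ has the corresponding mixture distribution, and $\mathbf E_\mu,\mathrm{Var}_\mu$ are its mean and variance. A customer with belief $\mu$ has differential utility for joining $$\hat\rho(\mu)=\tau-\big(\mathbf E_\mu[X]+\beta\sqrt{\mathrm{Var}_\mu[X]}\big);$$ joining is optimal iff $\hat\rho(\mu)\ge0$ and leaving is optimal iff $\hat\rho(\mu)\le0$. Let $\mathcal P_1=\{\mu:\hat\rho(\mu)\ge0\}$, $K_1=\{n\in\Omega:\hat\rho(e_n)\ge0\}$, $K_0=\{n\in\Omega:\hat\rho(e_n)\le0\}$, $L_0=\{n\in\Omega:\hat\rho(e_n)<0\}$ (states $n$ are identified with $e_n$). For $n\in L_0$, $m\in K_1$ let $\gamma(n,m)=\sup\{\gamma\in[0,1]:\gamma e_n+(1-\gamma)e_m\in\mathcal P_1\}$, $\chi(n,m)=\gamma(n,m)e_n+(1-\gamma(n,m))e_m$, and $K_{01}=\{\chi(n,m):n\in L_0,m\in K_1\}$. Signaling. A signaling scheme with finite signal set $S$ specifies conditional probabilities $\sigma(s\mid\omega)$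 of sending $s\in S$ to a customer arriving in state $\omega\in\Omega$; signals never sent are omitted from $S$. With customers following a strategy $a:S\to\{0,1\}$, let $p$ be the resulting stationary distribution of the queue length, and let $t_a(\omega)=p(\omega)\sum_{s:a(s)=a}\sigma(s\mid\omega)$ for $\omega\in\Omega$ be the joint probability of state $\omega$ and action $a$. The belief induced by $s$ is $\mu_s(\omega)\propto p(\omega)\sigma(s\mid\omega)$, $\omega\in\Omega$, and $a(s)$ is required to be optimal for belief $\mu_s$. The provider maximizes throughput, i.e. $\sum_\omega t_1(\omega)$. The provider's problem is formulated as the linear program $$\text{(Q)}\quad\max_{t_0,t_1}\sum_{\omega\in\Omega}t_1(\omega)\ \ \text{s.t.}\ \ t_1\in\mathrm{Conv}(K_1\cup K_{01}\cup\{\mathbf 0\}),\ \ t_0\in\mathrm{Conv}(L_0\cup\{\mathbf 0\}),$$ $$t_0(\omega+1)+t_1(\omega+1)=\lambda t_1(\omega)\ \ \forall\,\omega<C-1,\qquad \sum_{\omega}t_0(\omega)+\sum_\omega t_1(\omega)+\lambda t_1(C-1)=1,$$ and a signaling scheme is optimal if its induced $(t_0,t_1)$ is an optimal solution of (Q). Here $\mathrm{Conv}$ is the convex hull and $\mathbf 0$ the zero vector in $\mathbb R^\Omega$. *)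

(* Defs.v *)
From HB Require Import structures.
From mathcomp Require Import all_boot all_order all_algebra.
From mathcomp Require Import all_classical all_reals all_analysis.

Set Implicit Arguments.
Unset Strict Implicit.
Unset Printing Implicit Defensive.

Import Order.TTheory GRing.Theory Num.Theory.

Local Open Scope classical_set_scope.
Local Open Scope ring_scope.

(* Omega = {0, ..., C-1} is 'I_C, R^Omega is 'rV[R]_C, and the queue length
   lives in {0, ..., C} = 'I_C.+1. *)

Section geometry.
Context {R : realType} {C : nat}.
Implicit Types (n : 'I_C) (mu : 'rV[R]_C).

Definition simplex : set 'rV[R]_C :=
  [set mu | (forall n, 0 <= mu 0 n) /\ \sum_n mu 0 n = 1].

Definition point_mass n : 'rV[R]_C := delta_mx 0 n.

Definition convex_hull (A : set 'rV[R]_C) : set 'rV[R]_C :=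
  [set x | exists (k : nat) (c : 'I_k -> R) (y : 'I_k -> 'rV[R]_C),
     [/\ forall i, 0 <= c i, \sum_i c i = 1, forall i, A (y i)
       & x = \sum_i c i *: y i]].

End geometry.

Section waiting_law.
Context {R : realType}.
Local Notation TR := (measurableTypeR R).

Definition unit_exponential : set TR -> \bar R := exponential_prob 1.
HB.instance Definition _ := Probability.copy unit_exponential
  (exponential_distribution_exponential_prob__canonical__probability_measure_Probability (ltr01 : (0:R) < 1)).

Definition add_pair (z : TR * TR) : TR := (z.1 : R) + (z.2 : R).

Lemma measurable_add_pair : measurable_fun setT add_pair.
Proof. apply: measurable_realfun.measurable_funD; [exact: measurable_fst|exact: measurable_snd]. Qed.

HB.instance Definition _ :=
  @isMeasurableFun.Build _ _ _ _ add_pair measurable_add_pair.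

(* The law of a sum of n+1 independent unit-mean exponentials: independence is
   encoded by the product measure, the sum by the image law along addition. *)
Fixpoint waiting_law (n : nat) : probability TR R :=
  if n is m.+1 then distribution (waiting_law m \x unit_exponential)%E add_pair
  else unit_exponential.

End waiting_law.

Section mixture_law.
Context {R : realType} {C : nat}.
Local Notation TR := (measurableTypeR R).
Local Open Scope ereal_scope.
Variable mu : 'rV[R]_C.

Definition mixture_law : set TR -> \bar R :=
  fun A => \sum_(n < C) (mu 0%R n)%:E * waiting_law n A.

Hypothesis mu_simplex : simplex mu.

Let mu_ge0 n : (0 <= mu 0 n)%R. Proof. exact: mu_simplex.1. Qed.

Let mixture_law0 : mixture_law set0 = 0.
Proof. by rewrite /mixture_law big1// => n _; rewrite measure0 mule0. Qed.

Let mixture_law_ge0 A : 0 <= mixture_law A.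
Proof. by apply: sume_ge0 => n _; rewrite mule_ge0// lee_fin. Qed.

Let mixture_law_sigma_additive : semi_sigma_additive mixture_law.
Proof.
pose m k : {measure set TR -> \bar R} :=
  if insub k is Some n then mscale (NngNum (mu_ge0 n)) (waiting_law k)
  else mzero.
suff -> : mixture_law = msum m C by exact: measure_semi_sigma_additive.
apply/funext => A; apply: eq_bigr => n _.
by rewrite /m valK.
Qed.

HB.instance Definition _ := isMeasure.Build _ _ _ mixture_law
  mixture_law0 mixture_law_ge0 mixture_law_sigma_additive.

Let mixture_law_setT : mixture_law setT = 1.
Proof.
rewrite /mixture_law; under eq_bigr do rewrite probability_setT mule1.
by rewrite sumEFin mu_simplex.2.
Qed.

HB.instance Definition _ :=
  @Measure_isProbability.Build _ _ R mixture_law mixture_law_setT.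

End mixture_law.

Section moments.
Context {R : realType} {C : nat}.
Implicit Types (mu : 'rV[R]_C).

(* 'E_P[X] and 'V_P[X] for P := mixture_law mu and X the identity, unfolded
   because mixture_law mu is a probability only when mu is in the simplex. *)
Definition mean_wait mu : R :=
  fine (\int[mixture_law mu]_x x%:E)%E.

Definition var_wait mu : R :=
  fine (\int[mixture_law mu]_x ((x - mean_wait mu) ^+ 2)%:E)%E.

Section library_moments.
Local Open Scope ereal_scope.
Variables (mu : 'rV[R]_C) (P : probability (measurableTypeR R) R).
Hypothesis PE : P = mixture_law mu :> (set _ -> _).

Lemma mean_waitE : mean_wait mu = fine 'E_P[id].
Proof. by rewrite unlock PE. Qed.

Lemma var_waitE : var_wait mu = fine 'V_P[id].
Proof.
rewrite /variance covariance.unlock /var_wait mean_waitE expectation.unlock PE.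
by congr fine; apply: eq_integral => x _; rewrite /= expr2.
Qed.

End library_moments.

End moments.

Section customers.
Context {R : realType} {C : nat}.
Variables (tau beta : R).
Implicit Types (n m : 'I_C) (mu : 'rV[R]_C).

Definition rho mu : R :=
  tau - (mean_wait mu + beta * Num.sqrt (var_wait mu)).

Definition join_optimal mu : Prop := 0 <= rho mu.
Definition leave_optimal mu : Prop := rho mu <= 0.

Definition P1 : set 'rV[R]_C := [set mu | simplex mu /\ 0 <= rho mu].

Definition K1 : set 'I_C := [set n | 0 <= rho (point_mass n)].
Definition K0 : set 'I_C := [set n | rho (point_mass n) <= 0].
Definition L0 : set 'I_C := [set n | rho (point_mass n) < 0].

Definition segment (g : R) n m : 'rV[R]_C :=
  g *: point_mass n + (1 - g) *: point_mass m.

Definition gamma n m : R :=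
  sup [set g : R | 0 <= g <= 1 /\ P1 (segment g n m)].

Definition chi n m : 'rV[R]_C := segment (gamma n m) n m.

Definition K01 : set 'rV[R]_C :=
  [set x | exists n m, [/\ L0 n, K1 m & x = chi n m]].

End customers.

Section linear_program.
Context {R : realType} {C : nat}.
Variables (hC : (0 < C)%N) (lam tau beta : R).
Implicit Types (t : 'rV[R]_C).

Definition last_state : 'I_C := Ordinal (etrans (ltn_predL C) hC).

Definition lp_objective t1 : R := \sum_w t1 0 w.

Definition lp_feasible t0 t1 : Prop :=
  [/\ convex_hull ((point_mass @` K1 tau beta) `|` K01 tau beta `|` [set 0]) t1,
      convex_hull ((point_mass @` L0 tau beta) `|` [set 0]) t0,
      (forall w w' : 'I_C, w' = w.+1 :> nat ->
         t0 0 w' + t1 0 w' = lam * t1 0 w)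
    & \sum_w t0 0 w + \sum_w t1 0 w + lam * t1 0 last_state = 1].

Definition lp_optimal t0 t1 : Prop :=
  lp_feasible t0 t1 /\
  forall t0' t1', lp_feasible t0' t1' -> lp_objective t1' <= lp_objective t1.

End linear_program.

Section queue.
Context {R : realType} {C : nat}.
Variable lam : R.

(* An arrival at w < C and the queue length it finds, resp. leaves behind when
   it joins. *)
Definition before (w : 'I_C) : 'I_C.+1 := widen_ord (leqnSn C) w.
Definition after (w : 'I_C) : 'I_C.+1 := lift ord0 w.

(* Transition rates of the queue length when an arrival in state w joins with
   probability q w; arrivals at queue length C are blocked. *)
Definition queue_rate (q : 'I_C -> R) (i j : 'I_C.+1) : R :=
  \sum_(w < C | (i == before w) && (j == after w)) lam * q w +
  \sum_(w < C | (i == after w) && (j == before w)) 1.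

Definition stationary (q : 'I_C -> R) (p : 'I_C.+1 -> R) : Prop :=
  [/\ forall i, 0 <= p i, \sum_i p i = 1
    & forall j, \sum_i p i * queue_rate q i j =
                p j * \sum_k queue_rate q j k].

End queue.

Section signaling.
Context {R : realType} {C : nat}.
Context {S : finType}.
Implicit Types (sigma : 'I_C -> S -> R) (a : S -> bool) (p : 'I_C.+1 -> R).

(* sigma w s is the conditional probability of signal s in state w. *)
Definition is_signaling sigma : Prop :=
  (forall w s, 0 <= sigma w s) /\ (forall w, \sum_s sigma w s = 1).

Definition action_prob sigma a (b : bool) (w : 'I_C) : R :=
  \sum_(s | a s == b) sigma w s.

Definition signal_prob sigma p (s : S) : R :=
  \sum_w p (before w) * sigma w s.

Definition induced_belief sigma p (s : S) : 'rV[R]_C :=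
  \row_w (p (before w) * sigma w s / signal_prob sigma p s).

Definition induced_joint sigma a p (b : bool) : 'rV[R]_C :=
  \row_w (p (before w) * action_prob sigma a b w).

Definition obedient (tau beta : R) sigma a p : Prop :=
  forall s, if a s then join_optimal tau beta (induced_belief sigma p s)
            else leave_optimal tau beta (induced_belief sigma p s).

(* The clause 0 < signal_prob says that signals never sent are omitted. *)
Definition optimal_scheme (hC : (0 < C)%N) (lam tau beta : R) sigma a p : Prop :=
  [/\ is_signaling sigma,
      stationary lam (action_prob sigma a true) p,
      forall s, 0 < signal_prob sigma p s,
      obedient tau beta sigma a p
    & lp_optimal hC lam tau beta
        (induced_joint sigma a p false) (induced_joint sigma a p true)].

End signaling.

(* The signal set {Join_1, ..., Join_J, Leave}. *)
Definition signals (J : nat) : finType := option 'I_J.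
Definition Join {J : nat} (j : 'I_J) : signals J := Some j.
Definition Leave {J : nat} : signals J := None.
Definition follow {J : nat} (s : signals J) : bool := isSome s.

(* w1 1 <= ... <= w1 J <= w0 J <= ... <= w0 1 *)
Definition sandwich {C J : nat} (w0 w1 : 'I_J -> 'I_C) : bool :=
  sorted leq ([seq val (w1 j) | j <- enum 'I_J] ++
              rev [seq val (w0 j) | j <- enum 'I_J]).

(* Main.v *)
(* Up to the factor [1 / T], the utility of a belief with total mass [T] and
   unnormalised first two moments [A], [B] of the wait is the sublinear function
   [tau T - A - beta sqrt (B T - A^2)]; so along an edge from a joining state m to
   a leaving state n there is a single zero, at which one unit of mass at n is
   paired with some amount r(n, m) of mass at m. Hence t1 is feasible iff its mass
   on leaving states can be paired, with ratios r, within its mass on joining states.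

   Convexity gives r(n1, m2) r(n2, m1) <= r(n1, m1) r(n2, m2) for
   m1 < m2 < n1 < n2, so that exchanging a crossing pair of matches for a nested
   one never needs more mass on the joining states, and t1 has a nested pairing.
   If a state of positive utility had mass left over, some mass of t0 could be
   paired with it and moved to t1; as the probability of an empty queue is
   positive, this increases the throughput even after renormalisation. So at an
   optimum with t0 <> 0 the nested pairing, together with the mass at a state of
   zero utility if there is one, is a decomposition of all of t1 into beliefs of
   zero utility. Nested chords of the parabola of moments meet the zero set of the
   utility at increasing means, hence at decreasing variances. *)

From HB Require Import structures.
Require Import Defs.
From mathcomp Require Import all_boot all_order all_algebra.
From mathcomp Require Import all_classical all_reals all_analysis.
From mathcomp Require Import measurable_realfun zify ring lra.
Import Order.TTheory GRing.Theory Num.Theory.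
Import numFieldNormedType.Exports.
Local Open Scope ring_scope.

(** * Nested refinements of transport plans with ratios *)

Section uncrossing.
Context {R : realFieldType} {C : nat}.
Variables (rows cols : pred 'I_C) (r : 'I_C -> 'I_C -> R).
Hypothesis r_gt0 : forall n m, rows n -> cols m -> 0 < r n m.
Hypothesis r_submodular : forall n1 n2 m1 m2 : 'I_C, (m1 < m2)%N -> (n1 < n2)%N ->
  rows n1 -> rows n2 -> cols m1 -> cols m2 ->
  r n1 m2 * r n2 m1 <= r n1 m1 * r n2 m2.
Implicit Types x : 'I_C -> 'I_C -> R.

Definition supported_flow x : Prop :=
  forall n m, 0 <= x n m /\ (x n m != 0 -> rows n /\ cols m).

(** Row sums are prescribed by the mass on the leaving states, while column loads may fall: this
    only leaves more mass unpaired. *)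
Definition refines x' x : Prop :=
  [/\ supported_flow x', forall n, \sum_m x' n m = \sum_m x n m
    & forall m, \sum_n r n m * x' n m <= \sum_n r n m * x n m].

(** In the application the columns are states below the rows, so that the intervals from [m1] to [n]
    and from [m2] to [k] would cross. *)
Definition nested_row x (k : 'I_C) : Prop := forall (n m1 m2 : 'I_C),
  (n < k)%N -> (m1 < m2)%N -> x n m1 != 0 -> x k m2 != 0 -> False.

Lemma refines_refl x : supported_flow x -> refines x x.
Proof. by move=> fx; split. Qed.

Lemma refines_trans x1 x2 x3 : refines x1 x2 -> refines x2 x3 -> refines x1 x3.
Proof.
move=> [f1 r12 c12] [_ r23 c23]; split=> // [n|m]; first by rewrite r12.
exact: le_trans (c12 m) (c23 m).
Qed.

(** Mass [d] moves from [m1] to [m2] in row [n], and [d'] from [m2] to [m1] in row [k], so that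
    column [m2] keeps its load; by [r_submodular] the load of column [m1] does not grow. *)
Lemma swap_crossing x (n k m1 m2 : 'I_C) : supported_flow x -> (n < k)%N -> (m1 < m2)%N ->
  x n m1 != 0 -> x k m2 != 0 ->
  exists x', [/\ refines x' x,
    forall i j, x' i j != 0 -> [\/ x i j != 0, i = n /\ j = m2 | i = k /\ j = m1],
    forall i, i != n -> i != k -> x' i = x i
  & x' n m1 = 0 \/ x' k m2 = 0].
Proof.
move=> fx nk m12 xn xk.
have [xn0 /(_ xn) [rn cm1]] := fx n m1; have [xk0 /(_ xk) [rk cm2]] := fx k m2.
have r12 := r_gt0 _ _ rn cm2; have r22 := r_gt0 _ _ rk cm2.
(* The largest amount that keeps both [x n m1] and, after conversion by the ratios in column [m2],
   [x k m2] nonnegative; hence one of them is emptied. *)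
pose d := Num.min (x n m1) (x k m2 * (r k m2 / r n m2)).
pose d' := d * (r n m2 / r k m2).
have d0 : 0 <= d by rewrite le_min xn0 mulr_ge0// divr_ge0 ?ltW.
have d'0 : 0 <= d' by rewrite mulr_ge0// divr_ge0 ?ltW.
have dn : d <= x n m1 by rewrite ge_min lexx.
have dk : d' <= x k m2.
  by rewrite -ler_pdivlMr ?divr_gt0// invf_div ge_min lexx orbT.
have nkE : (k == n) = false by rewrite -val_eqE/= gtn_eqF.
have mE : (m2 == m1) = false by rewrite -val_eqE/= gtn_eqF.
have nkE' : (n == k) = false by rewrite eq_sym.
have mE' : (m1 == m2) = false by rewrite eq_sym.
pose x' i j := x i j + (i == n)%:R * (d * ((j == m2)%:R - (j == m1)%:R))
                     + (i == k)%:R * (d' * ((j == m1)%:R - (j == m2)%:R)).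
have x'n m1' : x' n m1' = x n m1' + d * ((m1' == m2)%:R - (m1' == m1)%:R).
  by rewrite /x' eqxx nkE' mul1r mul0r addr0.
have x'k m1' : x' k m1' = x k m1' + d' * ((m1' == m1)%:R - (m1' == m2)%:R).
  by rewrite /x' eqxx nkE mul1r mul0r addr0.
have x'E i : i != n -> i != k -> x' i = x i.
  move=> /negbTE iN /negbTE ik; rewrite /x' iN ik.
  apply: funext => j; by rewrite !mul0r !addr0.
exists x'; split => //.
- split.
  + move=> i j.
    have [->|iN] := eqVneq i n.
      rewrite x'n; have [jm2|jm2] := eqVneq j m2.
        by subst j; rewrite mE subr0 mulr1; split; [have [] := fx n m2; lra|].
      have [jm1|jm1] := eqVneq j m1.
        by subst j; rewrite sub0r mulrN1; split; [lra|].
      by rewrite subrr mulr0 addr0; exact: fx.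
    have [->|ik] := eqVneq i k.
      rewrite x'k; have [jm1|jm1] := eqVneq j m1.
        by subst j; rewrite mE' subr0 mulr1; split; [have [] := fx k m1; lra|].
      have [jm2|jm2] := eqVneq j m2.
        by subst j; rewrite sub0r mulrN1; split; [lra|].
      by rewrite subrr mulr0 addr0; exact: fx.
    by rewrite x'E//; exact: fx.
  + have sum1 (a : 'I_C) : \sum_(j < C) (j == a)%:R = 1 :> R.
      by rewrite (bigD1 a)//= eqxx big1 ?addr0// => j /negbTE ->.
    move=> i; rewrite /x' !big_split/= -!mulr_sumr !sumrB !sum1.
    by rewrite subrr !mulr0 !addr0.
  + have sum1 (a : 'I_C) (f : 'I_C -> R) : \sum_i f i * (i == a)%:R = f a.
      rewrite (bigD1 a)//= eqxx mulr1 big1 ?addr0// => j /negbTE ->.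
      by rewrite mulr0.
    move=> j.
    have -> : \sum_i r i j * x' i j = \sum_i r i j * x i j +
        (r n j * (d * ((j == m2)%:R - (j == m1)%:R)) +
         r k j * (d' * ((j == m1)%:R - (j == m2)%:R))).
      rewrite -(sum1 n (fun i => r i j * (d * ((j == m2)%:R - (j == m1)%:R)))).
      rewrite -(sum1 k (fun i => r i j * (d' * ((j == m1)%:R - (j == m2)%:R)))).
      by rewrite -!big_split/=; apply: eq_bigr => i _; rewrite /x'; ring.
    rewrite gerDl.
    have [jm2|jm2] := eqVneq j m2.
      subst j; rewrite mE /d'.
      have -> : r n m2 * (d * (1 - 0)) + r k m2 * (d * (r n m2 / r k m2) * (0 - 1)) = 0.
        by field; rewrite gt_eqF.
      by [].
    have [jm1|jm1] := eqVneq j m1; last by rewrite !subrr !mulr0 addr0.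
    subst j; rewrite /d'.
    have -> : r n m1 * (d * (0 - 1)) + r k m1 * (d * (r n m2 / r k m2) * (1 - 0)) =
      - (d / r k m2) * (r n m1 * r k m2 - r n m2 * r k m1).
      by field; rewrite gt_eqF.
    rewrite mulNr oppr_le0; apply: mulr_ge0; first by rewrite divr_ge0// ltW.
    by rewrite subr_ge0; exact: r_submodular.
- move=> i j.
  have [->|iN] := eqVneq i n.
    rewrite x'n; have [->|jm2] := eqVneq j m2; first by move=> _; constructor 2.
    have [->|jm1] := eqVneq j m1; first by move=> _; constructor 1.
    by rewrite subrr mulr0 addr0; constructor 1.
  have [->|ik] := eqVneq i k.
    rewrite x'k; have [->|jm1] := eqVneq j m1; first by move=> _; constructor 3.
    have [->|jm2] := eqVneq j m2; first by move=> _; constructor 1.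
    by rewrite subrr mulr0 addr0; constructor 1.
  by rewrite x'E//; constructor 1.
- rewrite x'n x'k !eqxx mE mE' !sub0r !mulrN1.
  have [h|h] := leP (x n m1) (x k m2 * (r k m2 / r n m2)); [left|right].
    by rewrite /d min_l// subrr.
  rewrite /d' /d min_r ?ltW//; field.
  by rewrite !gt_eqF.
Qed.

(* The crossings of row [k] are removed starting from its last column [M]: each
   exchange empties either the entry in column [M] of row [k], or an entry below
   column [M] in an earlier row. *)
Lemma nest_row x (k : 'I_C) : supported_flow x ->
  (forall k' : 'I_C, (k < k')%N -> nested_row x k') ->
  exists x', refines x' x /\ forall k' : 'I_C, (k <= k')%N -> nested_row x' k'.
Proof.
move=> fx above.
pose low x M := [set p : 'I_C * 'I_C | [&& (p.1 < k)%N, (p.2 < M)%N & x p.1 p.2 != 0]].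
(* The lexicographic order on [M] and the size of [low x M] is coded as one number, that size being
   at most [C * C]. *)
suff main w M : forall x, supported_flow x ->
    (forall k' : 'I_C, (k < k')%N -> nested_row x k') ->
    (forall m, x k m != 0 -> (m <= M)%N) ->
    (M * (C * C).+1 + #|low x M| < w)%N ->
    exists x', refines x' x /\ forall k' : 'I_C, (k <= k')%N -> nested_row x' k'.
  by apply: (main _ C x fx above _ (ltnSn _)) => m _; exact: ltnW.
elim: w M => // w IH M {}x {}fx {}above bnd meas.
have [/existsP[[i j]]|none] := boolP [exists p, p \in low x M]; last first.
  exists x; split=> [|k']; first exact: refines_refl.
  rewrite leq_eqVlt => /orP[/eqP/val_inj <-|/above//] n m1 m2 nk m12 xn xk.
  move/negP: none; apply; apply/existsP; exists (n, m1); rewrite inE /= nk xn andbT.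
  exact: leq_trans m12 (bnd _ xk).
rewrite inE /= => /and3P[ik jM xij].
have lowC M' x' : (#|low x' M'| <= C * C)%N.
  by rewrite (leq_trans (max_card _))// card_prod !card_ord.
have [/existsP[m /andP[/eqP mM xkm]]|none] :=
  boolP [exists m : 'I_C, (val m == M) && (x k m != 0)]; last first.
  have bnd' (m : 'I_C) : x k m != 0 -> (m <= M.-1)%N.
    move=> xkm; have := bnd _ xkm; rewrite leq_eqVlt => /orP[/eqP mM|].
      by move/negP: none => []; apply/existsP; exists m; rewrite /= mM eqxx.
    by move: jM; clear; lia.
  apply: (IH M.-1 x) => //; have := lowC M.-1 x; move: meas jM; clear; nia.
have jm : (j < m)%N by rewrite mM.
have [x' [x'x x'supp x'E x'0]] := swap_crossing _ _ _ _ _ fx ik jm xij xkm.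
have fx' : supported_flow x' by case: x'x.
(* A new entry shares its column with an old nonzero entry of row [k] or [i], which would already
   cross row [k']. *)
have above' (k' : 'I_C) : (k < k')%N -> nested_row x' k'.
  move=> kk' n m1 m2 nk' m12 x'n x'k.
  have xk : x k' m2 != 0.
    by move: x'k; rewrite x'E// -val_eqE/= ?gtn_eqF// (ltn_trans ik).
  have [xn|[_ m1E]|[_ m1E]] := x'supp _ _ x'n.
  - exact: (above k' kk' n m1 m2).
  - by subst m1; exact: (above k' kk' k m m2).
  - by subst m1; apply: (above k' kk' i j m2) => //; exact: ltn_trans ik kk'.
have bnd' (m' : 'I_C) : x' k m' != 0 -> (m' <= M)%N.
  move=> /x'supp[/bnd//|[kE _]|[_ ->]]; last exact: ltnW.
  by move: ik; rewrite kE ltnn.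
have [x'ij|x'km] := x'0.
  (* The only possible new entries are not counted: [(i, m)] lies in column [M], and [(k, j)] in row
     [k]. *)
  have lowlt : (#|low x' M| < #|low x M|)%N.
    apply/proper_card/properP; split.
      apply/fintype.subsetP => -[a b]; rewrite !inE /= => /and3P[ak bM x'ab].
      rewrite ak bM /=; have [//|[_ bE]|[aE _]] := x'supp _ _ x'ab.
        by move: bM; rewrite bE mM ltnn.
      by move: ak; rewrite aE ltnn.
    by exists (i, j); rewrite inE /= ?ik ?jM ?xij// x'ij eqxx !andbF.
  have meas' : (M * (C * C).+1 + #|low x' M| < w)%N.
    by move: lowlt meas; clear; lia.
  have [y [yx' yn]] := IH M x' fx' above' bnd' meas'.
  by exists y; split=> //; exact: refines_trans yx' x'x.
have bnd'' (m' : 'I_C) : x' k m' != 0 -> (m' <= M.-1)%N.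
  move=> x'km'; have := bnd' _ x'km'.
  rewrite leq_eqVlt => /orP[/eqP m'M|]; last by move: jM; clear; lia.
  by move: x'km'; rewrite (_ : m' = m) ?x'km ?eqxx//; apply: val_inj; rewrite /= m'M mM.
have meas' : (M.-1 * (C * C).+1 + #|low x' M.-1| < w)%N.
  by have := lowC M.-1 x'; move: meas jM; clear; nia.
have [y [yx' yn]] := IH M.-1 x' fx' above' bnd'' meas'.
by exists y; split=> //; exact: refines_trans yx' x'x.
Qed.

Lemma nested_flow_exists x : supported_flow x ->
  exists x', refines x' x /\ forall k, nested_row x' k.
Proof.
move=> fx.
(* Rows are treated from the last to the first, since [nest_row] keeps the later ones nested; [d]
   counts those done. *)
suff main d : exists x', refines x' x /\ forall k : 'I_C, (C <= k + d)%N -> nested_row x' k.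
  have [x' [x'x nx']] := main C; exists x'; split=> // k; apply: nx'.
  exact: leq_addl.
elim: d => [|d [x1 [x1x n1]]].
  exists x; split; first exact: refines_refl.
  by move=> k; rewrite addn0 leqNgt ltn_ord.
have [dC|dC] := ltnP d C; last first.
  by exists x1; split=> // k _; apply: n1; rewrite (leq_trans dC) ?leq_addl.
have kC : (C - d.+1 < C)%N by move: dC; clear; lia.
have fx1 : supported_flow x1 by case: x1x.
have above (k' : 'I_C) : (Ordinal kC < k')%N -> nested_row x1 k'.
  by move=> /= hk; apply: n1; move: hk dC; clear; lia.
have [x' [x'x n']] := nest_row _ _ fx1 above.
exists x'; split; first exact: refines_trans x'x x1x.
by move=> k hk; apply: n'; rewrite /=; move: hk dC; clear; lia.
Qed.

End uncrossing.

Local Open Scope classical_set_scope.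
Local Open Scope ring_scope.

(** * Moments of the waiting time *)

Section density.
Local Open Scope ereal_scope.
Context d (T : measurableType d) (R : realType).
Variables (nu mu : {measure set T -> \bar R}) (g : T -> R).
Hypothesis g0 : forall x, (0 <= g x)%R.
Hypothesis mg : measurable_fun setT g.
Hypothesis nuE : forall A, measurable A -> nu A = \int[mu]_(x in A) (g x)%:E.

Import HBNNSimple.

Let density_nnsfun (f : {nnsfun T >-> R}) :
  \int[nu]_x (f x)%:E = \int[mu]_x ((f x)%:E * (g x)%:E).
Proof.
under [LHS]eq_integral do rewrite fimfunE -fsumEFin//.
rewrite [LHS]ge0_integral_fsum//; last 2 first.
  - by move=> r; exact/measurable_EFinP/measurableT_comp.
  - by move=> n x _; rewrite EFinM nnfun_muleindic_ge0.
under [RHS]eq_integral.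
  move=> x xD; rewrite fimfunE -fsumEFin// ge0_mule_fsuml; last first.
    by move=> r; rewrite EFinM nnfun_muleindic_ge0.
  over.
rewrite [RHS]ge0_integral_fsum//; last 2 first.
  - move=> r; apply: emeasurable_funM; apply/measurable_EFinP => //.
    exact/measurableT_comp.
  - move=> n x _; apply: mule_ge0; last by rewrite lee_fin.
    by rewrite EFinM nnfun_muleindic_ge0.
apply: eq_fsbigr => r /[!inE] rf.
rewrite integralZl_indic_nnsfun//= integral_indic// setIT nuE//.
have r0 : (0 <= r)%R by case: rf => x _ <-.
under [RHS]eq_integral do rewrite EFinM -muleA.
rewrite ge0_integralZl//; last 2 first.
  - apply: emeasurable_funM; apply/measurable_EFinP => //.
  - by move=> x _; rewrite mule_ge0// lee_fin.
congr (_ * _); rewrite integral_mkcond; apply: eq_integral => x _.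
rewrite patchE indicE; case: ifPn => xA; first by rewrite mul1e.
by rewrite mul0e.
Qed.

(** Simple functions reduce to indicators, where [nuE] applies; monotone convergence does the
    rest. *)
Lemma ge0_integral_density (f : T -> \bar R) :
  measurable_fun setT f -> (forall x, 0 <= f x) ->
  \int[nu]_x f x = \int[mu]_x (f x * (g x)%:E).
Proof.
move=> mf f0; pose f_ := nnsfun_approx measurableT mf.
transitivity (limn (fun n => \int[nu]_x (f_ n x)%:E)).
  rewrite -monotone_convergence//=.
  - apply: eq_integral => x _; apply/esym/cvg_lim => //.
    exact: cvg_nnsfun_approx.
  - by move=> n; exact/measurable_EFinP/measurable_funTS.
  - by move=> n x _; rewrite lee_fin.
  - by move=> x _ m n mn; rewrite lee_fin; exact/lefP/nd_nnsfun_approx.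
under eq_fun do rewrite density_nnsfun.
rewrite -monotone_convergence//=.
- apply: eq_integral => x _; apply/cvg_lim => //.
  by apply: cvgeZr => //; exact: cvg_nnsfun_approx.
- move=> n; apply: emeasurable_funM; apply/measurable_EFinP => //.
- by move=> n x _; rewrite mule_ge0// lee_fin.
- move=> x _ m n mn; rewrite lee_wpmul2r ?lee_fin//.
  exact/lefP/nd_nnsfun_approx.
Qed.

End density.

Section exponential_moments.
Context {R : realType}.
Local Notation TR := (measurableTypeR R).

Lemma quadratic_expRN_cvg0 (c d e : R) : 0 <= c -> 0 <= d -> 0 <= e ->
  - ((c * x ^+ 2 + d * x + e) * expR (- x)) @[x --> +oo%R] --> (0 : R).
Proof.
move=> c0 d0 e0; rewrite -oppr0; apply: cvgN.
(* For [x >= 1] the quadratic is at most [(c + d + e) * x ^+ 2], while [expR x >= x ^+ 3 / 6]; the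
   product is then at most [K / x]. *)
set K := (c + d + e) * 6; apply/cvgrPdist_le => eps eps0.
near=> x.
have x1 : 1 <= x by near: x; apply: nbhs_pinfty_ge; exact: num_real.
have x0 : 0 < x by exact: lt_le_trans x1.
have xK : K / eps <= x by near: x; apply: nbhs_pinfty_ge; exact: num_real.
have q0 : 0 <= c * x ^+ 2 + d * x + e.
  by rewrite !addr_ge0// mulr_ge0// ?exprn_ge0// ltW.
rewrite sub0r normrN ger0_norm ?mulr_ge0 ?expR_ge0//.
rewrite expRN ler_pdivrMr ?expR_gt0//.
have ex : x ^+ 3 / 6 <= expR x.
  have := expR_ge1Dxn 2 (ltW x0).
  rewrite (_ : (3`!)%:R = 6 :> R)//; lra.
apply: (@le_trans _ _ (eps * (x ^+ 3 / 6))); last by rewrite ler_pM2l.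
have qK : c * x ^+ 2 + d * x + e <= K / 6 * x ^+ 2.
  have -> : K / 6 = c + d + e by rewrite /K; field.
  have xx : x <= x ^+ 2 by rewrite expr2 ler_peMl// ltW.
  have := ler_wpM2l d0 xx; have := ler_wpM2l e0 (le_trans x1 xx); lra.
apply: (le_trans qK).
rewrite (_ : eps * (x ^+ 3 / 6) = (eps * x) / 6 * x ^+ 2); last by ring.
rewrite ler_wpM2r ?exprn_ge0 ?(ltW x0)// ler_pM2r ?invr_gt0//.
by rewrite mulrC -ler_pdivrMr.
Unshelve. all: end_near. Qed.

Lemma integral_quadratic_expRN (a b c : R) : 0 <= a -> 0 <= b -> 0 <= c ->
  (\int[lebesgue_measure]_(x in `[0%R, +oo[)
     ((a + b * x + c * x ^+ 2) * expR (- x))%:E = (a + b + 2 * c)%:E)%E.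
Proof.
move=> a0 b0 c0.
(* The antiderivative that vanishes at infinity, found by repeated integration by parts. *)
pose F x : R := - ((c * x ^+ 2 + (b + 2 * c) * x + (a + b + 2 * c)) * expR (- x)).
have dF (x : R) : is_derive x 1 F ((a + b * x + c * x ^+ 2) * expR (- x)).
  apply: is_derive_eq.
  by rewrite /GRing.scale /=; ring.
have cF (f : R -> R) : (forall x : R, derivable f x 1) -> continuous f.
  by move=> df x; apply: differentiable_continuous; exact/derivable1_diffP.
rewrite (@ge0_continuous_FTC2y _ _ F 0 0).
- by rewrite /F oppr0 expR0 -EFinB; congr (_%:E); ring.
- by move=> x x0; rewrite mulr_ge0 ?expR_ge0// !addr_ge0 ?mulr_ge0 ?sqr_ge0.
- by apply: continuous_subspaceT; apply: cF => x; exact: ex_derive.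
- by apply: quadratic_expRN_cvg0; rewrite ?addr_ge0 ?mulr_ge0.
- by move=> x _; exact: ex_derive.
- apply: cvg_at_right_filter; apply: cF => x; exact: ex_derive.
- by move=> x _; rewrite derive1E; exact: derive_val.
Qed.

Lemma integral_unit_exponential (f : R -> \bar R) (a b c : R) :
  measurable_fun setT f -> (forall x, 0 <= f x)%E ->
  0 <= a -> 0 <= b -> 0 <= c ->
  (forall x, 0 <= x -> f x = (a + b * x + c * x ^+ 2)%:E) ->
  (\int[@unit_exponential R]_x f x = (a + b + 2 * c)%:E)%E.
Proof.
move=> mf f0 a0 b0 c0 fE.
rewrite (@ge0_integral_density _ _ _ _ lebesgue_measure (exponential_pdf 1))//; last 2 first.
  by move=> x; exact: exponential_pdf_ge0.
  exact: measurable_exponential_pdf.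
rewrite -(integral_quadratic_expRN _ _ _ a0 b0 c0).
rewrite [RHS]integral_mkcond; apply: eq_integral => x _.
rewrite /exponential_pdf !patchE; case: ifPn; last by rewrite mule0.
rewrite inE/= in_itv/= andbT => x0; rewrite fE// mul1r mulN1r.
by [].
Qed.

(* Prescribing [f] on the nonnegative reals only makes the induction yield at once
   that the law puts no mass on the negative reals. *)
Lemma integral_waiting_law n (f : R -> \bar R) (a b c : R) :
  measurable_fun setT f -> (forall x, 0 <= f x)%E ->
  0 <= a -> 0 <= b -> 0 <= c ->
  (forall x, 0 <= x -> f x = (a + b * x + c * x ^+ 2)%:E) ->
  (\int[@waiting_law R n]_x f x =
    (a + b * n.+1%:R + c * (n.+1%:R * n.+2%:R))%:E)%E.
Proof.
elim: n f a b c => [|n IH] f a b c mf f0 a0 b0 c0 fE.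
  by rewrite /= (integral_unit_exponential f a b c)//; congr (_%:E); ring.
have mf2 : measurable_fun setT (f \o (@Defs.add_pair R)).
  exact: measurableT_comp (@measurable_add_pair R).
rewrite /= ge0_integral_distribution//.
rewrite fubini_tonelli1//; last by move=> x; exact: f0.
(* Integrating [a + b (x + y) + c (x + y)^2] over the last exponential [y], of moments 1 and 2,
   leaves a quadratic in [x] with these coefficients. *)
rewrite (IH _ (a + b + 2 * c) (b + 2 * c) c)//.
- by congr (_%:E); rewrite -!natr1; ring.
- by apply: measurable_fun_fubini_tonelli_F => // x; exact: f0.
- by move=> x; apply: integral_ge0 => y _; exact: f0.
- by rewrite !addr_ge0// mulr_ge0.
- by rewrite !addr_ge0// mulr_ge0.
move=> x x0; rewrite /fubini_F.
rewrite (integral_unit_exponential _ (a + b * x + c * x ^+ 2) (b + 2 * c * x) c)//.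
- by congr (_%:E); ring.
- by apply: measurableT_comp => //; apply: measurableT_comp (@measurable_add_pair R) _.
- by move=> y; exact: f0.
- by rewrite !addr_ge0 ?mulr_ge0 ?sqr_ge0.
- by rewrite !addr_ge0 ?mulr_ge0.
move=> y y0; rewrite /= fE /Defs.add_pair/= ?addr_ge0//; congr (_%:E); ring.
Qed.

End exponential_moments.

Lemma measurable_norm_EFin {R : realType} :
  measurable_fun [set: measurableTypeR R] (fun x : R => (`|x|)%:E).
Proof. by apply: measurableT_comp => //; exact: normr_measurable. Qed.

Section mixture_moments.
Context {R : realType} {C : nat}.
Local Notation TR := (measurableTypeR R).
Variable mu : 'rV[R]_C.
Hypothesis mu_simplex : simplex mu.

Let mu_ge0 n : 0 <= mu 0 n. Proof. exact: mu_simplex.1. Qed.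

Let component k : {measure set TR -> \bar R} :=
  if insub k is Some n then mscale (NngNum (mu_ge0 n)) (waiting_law k) else mzero.

Let mixture_lawE : mixture_law mu = msum component C.
Proof.
apply/funext => A; rewrite /msum /=; apply: eq_bigr => n _.
by rewrite /component valK.
Qed.

Definition moment1 : R := \sum_n mu 0 n * n.+1%:R.
Definition moment2 : R := \sum_n mu 0 n * (n.+1%:R * n.+2%:R).

Lemma integral_mixture_law (f : R -> \bar R) (a b c : R) :
  measurable_fun setT f -> (forall x, 0 <= f x)%E ->
  0 <= a -> 0 <= b -> 0 <= c ->
  (forall x, 0 <= x -> f x = (a + b * x + c * x ^+ 2)%:E) ->
  (\int[mixture_law mu]_x f x = (a + b * moment1 + c * moment2)%:E)%E.
Proof.
move=> mf f0 a0 b0 c0 fE.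
rewrite mixture_lawE ge0_integral_measure_sum//.
transitivity (\sum_(n < C) (mu 0 n * (a + b * n.+1%:R + c * (n.+1%:R * n.+2%:R)))%:E)%E.
  apply: eq_bigr => n _; rewrite /component valK ge0_integral_mscale//=.
  by rewrite (integral_waiting_law _ f a b c).
rewrite sumEFin; congr (_%:E).
rewrite /moment1 /moment2 !mulr_sumr -[a in RHS]mul1r -mu_simplex.2 mulr_suml.
by rewrite -!big_split/=; apply: eq_bigr => n _; ring.
Qed.

Lemma mean_wait_simplex : mean_wait mu = moment1.
Proof.
rewrite /mean_wait.
suff -> : (\int[mixture_law mu]_x x%:E = moment1%:E)%E by [].
(* [integral_mixture_law] wants a nonnegative integrand. The norm differs from the identity only on
   the negative reals, a null set by the same lemma with zero coefficients. *)
transitivity (\int[mixture_law mu]_x (`|x|)%:E)%E.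
  rewrite mixture_lawE; apply: ae_eq_integral => //=.
    exact: measurable_norm_EFin.
  exists [set x : R | x < 0]; split.
  - by rewrite -set_itvNyo; exact: measurable_itv.
  - have mA : measurable [set x : R | x < 0].
      by rewrite -set_itvNyo; exact: measurable_itv.
    transitivity (\int[msum component C]_x (\1_[set x : R | x < 0] x)%:E)%E.
      by rewrite integral_indic// setIT.
    rewrite -mixture_lawE.
    rewrite (integral_mixture_law _ 0 0 0)//.
    + by congr (_%:E); ring.
    + by apply/measurable_EFinP; exact: measurable_indic.
    + move=> x x0; rewrite indicE memNset/= ?ltNge ?x0//; congr (_%:E); ring.
  move=> x /= h; rewrite ltNge; apply/negP => x0; apply: h => _.
  by rewrite ger0_norm.
rewrite (integral_mixture_law _ 0 1 0)//.
- by congr (_%:E); ring.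
- exact: measurable_norm_EFin.
- by move=> x x0; rewrite ger0_norm//; congr (_%:E); ring.
Qed.

Lemma var_wait_simplex : var_wait mu = moment2 - moment1 ^+ 2.
Proof.
rewrite /var_wait mean_wait_simplex.
set m := moment1; set V := (\int[_]_x _)%E.
have m0 : 0 <= m by apply: sumr_ge0 => n _; rewrite mulr_ge0.
have mV : measurable_fun setT (fun x : R => ((x - m) ^+ 2)%:E).
  by apply/measurable_EFinP; apply: measurable_funX; apply: measurable_funB.
have mN : measurable_fun setT (fun x : R => (`|x|)%:E).
  exact: measurable_norm_EFin.
(* The square has the linear coefficient [- 2 * m], of the wrong sign for [integral_mixture_law];
   the integral of [2 m |x|] is added on both sides. *)
have VE : (V + (2 * m * m)%:E = (m ^+ 2 + moment2)%:E)%E.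
  have -> : ((2 * m * m)%:E = \int[mixture_law mu]_x (2 * m * `|x|)%:E)%E.
    rewrite (integral_mixture_law _ 0 (2 * m) 0)//; rewrite ?mulr_ge0//.
    - by rewrite -/m; congr (_%:E); ring.
    - by apply: (measurable_funeM (2 * m)%:E) mN.
    - by move=> x; rewrite lee_fin !mulr_ge0.
    - by move=> x x0; rewrite ger0_norm//; congr (_%:E); ring.
  transitivity (\int[mixture_law mu]_x (((x - m) ^+ 2)%:E + (2 * m * `|x|)%:E))%E.
    rewrite /V mixture_lawE ge0_integralD//.
    - by move=> x _; rewrite lee_fin sqr_ge0.
    - by move=> x _; rewrite lee_fin !mulr_ge0.
    - by apply: (measurable_funeM (2 * m)%:E) mN.
  rewrite (integral_mixture_law _ (m ^+ 2) 0 1)//; rewrite ?sqr_ge0//.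
  - by congr (_%:E); ring.
  - by apply: emeasurable_funD => //; apply: (measurable_funeM (2 * m)%:E) mN.
  - by move=> x; rewrite -EFinD lee_fin addr_ge0 ?sqr_ge0// !mulr_ge0.
  - by move=> x x0; rewrite -EFinD ger0_norm//; congr (_%:E); ring.
suff -> : V = (moment2 - m ^+ 2)%:E by [].
move: V VE => [v||]//= [VE]; congr (_%:E); lra.
Qed.

End mixture_moments.

(** * Zeros of the utility on pairs of states *)

Section excess.
Context {R : realType}.
Variables (tau beta : R).
Hypothesis beta_ge0 : 0 <= beta.

Definition excess (T A B : R) : R :=
  tau * T - A - beta * Num.sqrt (B * T - A ^+ 2).

Lemma excessZ c T A B : 0 <= c ->
  excess (c * T) (c * A) (c * B) = c * excess T A B.
Proof.
move=> c0; rewrite /excess.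
have -> : c * B * (c * T) - (c * A) ^+ 2 = c ^+ 2 * (B * T - A ^+ 2) by ring.
by rewrite sqrtrM ?sqr_ge0// sqrtr_sqr ger0_norm//; ring.
Qed.

(** The square root term is superadditive: after squaring and multiplying by [T * T'], the gap is a
    sum of two squares. *)
Lemma excess_subadd T A B T' A' B' : 0 < T -> 0 < T' ->
  A ^+ 2 <= B * T -> A' ^+ 2 <= B' * T' ->
  excess (T + T') (A + A') (B + B') <= excess T A B + excess T' A' B'.
Proof.
move=> T0 T'0 h h'; rewrite /excess.
set s := Num.sqrt (B * T - _); set s' := Num.sqrt (B' * T' - _).
suff : s + s' <= Num.sqrt ((B + B') * (T + T') - (A + A') ^+ 2).
  by move=> /(ler_wpM2l beta_ge0); lra.
have s0 : 0 <= s by exact: sqrtr_ge0.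
have s'0 : 0 <= s' by exact: sqrtr_ge0.
have sE : s ^+ 2 = B * T - A ^+ 2 by rewrite sqr_sqrtr// subr_ge0.
have s'E : s' ^+ 2 = B' * T' - A' ^+ 2 by rewrite sqr_sqrtr// subr_ge0.
rewrite -[s + s']ger0_norm ?addr_ge0// -sqrtr_sqr ler_wsqrtr//.
suff : 0 <= B * T' + B' * T - 2 * A * A' - 2 * s * s' by nra.
rewrite -(pmulr_rge0 _ (mulr_gt0 T0 T'0)).
have -> : T * T' * (B * T' + B' * T - 2 * A * A' - 2 * s * s') =
    (T' * s - T * s') ^+ 2 + (T' * A - T * A') ^+ 2.
  transitivity (T' ^+ 2 * (B * T) + T ^+ 2 * (B' * T') - 2 * T * T' * A * A'
    - 2 * T * T' * s * s'); first by ring.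
  have -> : B * T = s ^+ 2 + A ^+ 2 by rewrite sE; ring.
  have -> : B' * T' = s' ^+ 2 + A' ^+ 2 by rewrite s'E; ring.
  by ring.
by rewrite addr_ge0 ?sqr_ge0.
Qed.

(* Mass [a] on a state of mean wait [x] and mass [b] on one of mean wait [y]:
   a sum of k unit exponentials has mean k and second moment k (k + 1). *)
Definition excess2 (a x b y : R) : R :=
  excess (a + b) (a * x + b * y) (a * (x * (x + 1)) + b * (y * (y + 1))).

(** A sum of unit exponentials has variance equal to its mean, so this is the utility at a single
    state of mean wait [x]. *)
Definition excess1 (x : R) : R := tau - x - beta * Num.sqrt x.

(** The law of total variance, times the squared total mass: the variance within the states, then
    the spread between them. *)
Let dispersion (a x b y : R) :
  (a * (x * (x + 1)) + b * (y * (y + 1))) * (a + b) - (a * x + b * y) ^+ 2 =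
  (a + b) * (a * x + b * y) + a * b * (x - y) ^+ 2.
Proof. by ring. Qed.

Let dispersion_ge0 (a x b y : R) : 0 <= a -> 0 <= b -> 0 <= x -> 0 <= y ->
  (a * x + b * y) ^+ 2 <= (a * (x * (x + 1)) + b * (y * (y + 1))) * (a + b).
Proof.
move=> a0 b0 x0 y0; rewrite -subr_ge0 dispersion.
by apply: addr_ge0; apply: mulr_ge0; rewrite ?sqr_ge0 ?addr_ge0 ?mulr_ge0.
Qed.

Lemma excess2Z c a x b y : 0 <= c ->
  excess2 (c * a) x (c * b) y = c * excess2 a x b y.
Proof. by move=> c0; rewrite -excessZ//; congr excess; ring. Qed.

Lemma excess2C a x b y : excess2 a x b y = excess2 b y a x.
Proof. by congr excess; ring. Qed.

Lemma excess2_0 x y : excess2 1 x 0 y = excess1 x.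
Proof. by rewrite /excess2 /excess dispersion /excess1; congr (_ - _ * Num.sqrt _); ring. Qed.

Lemma excess2_diag a b x : a + b = 1 -> excess2 a x b x = excess1 x.
Proof.
move=> ab; rewrite /excess2 /excess dispersion -mulrDl ab /excess1 subrr.
by rewrite expr0n /= mulr0 addr0 !mul1r mulr1.
Qed.

Lemma excess2_subadd a x b y a' x' b' y' :
  0 <= a -> 0 <= b -> 0 <= a' -> 0 <= b' ->
  0 <= x -> 0 <= y -> 0 <= x' -> 0 <= y' ->
  0 < a + b -> 0 < a' + b' ->
  excess (a + b + (a' + b')) (a * x + b * y + (a' * x' + b' * y'))
    (a * (x * (x + 1)) + b * (y * (y + 1)) +
     (a' * (x' * (x' + 1)) + b' * (y' * (y' + 1)))) <=
  excess2 a x b y + excess2 a' x' b' y'.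
Proof. by move=> *; apply: excess_subadd => //; exact: dispersion_ge0. Qed.

Lemma excess1_decr x y : x < y -> excess1 y < excess1 x.
Proof.
move=> xy; rewrite /excess1.
have := ler_wpM2l beta_ge0 (ler_wsqrtr (ltW xy)); lra.
Qed.

(** By subadditivity the extra mass adds at most [z * excess1 x]. *)
Lemma excess2_toward a b z x y : 0 <= x -> 0 <= y -> excess1 x < 0 ->
  0 <= a -> 0 <= b -> 0 < a + b -> excess2 a x b y <= 0 -> 0 < z ->
  excess2 (a + z) x b y < 0.
Proof.
move=> x0 y0 ex a0 b0 ab0 e0 z0.
apply: (@le_lt_trans _ _ (excess2 a x b y + excess2 z x 0 y)).
  have -> : excess2 (a + z) x b y =
    excess (a + b + (z + 0)) (a * x + b * y + (z * x + 0 * y))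
    (a * (x * (x + 1)) + b * (y * (y + 1)) +
     (z * (x * (x + 1)) + 0 * (y * (y + 1)))) by congr excess; ring.
  by apply: excess2_subadd; rewrite ?addr0// ltW.
have -> : excess2 z x 0 y = z * excess1 x.
  by rewrite -(excess2_0 x y) -excess2Z ?(ltW z0)// mulr1 mulr0.
by have : z * excess1 x < 0; [rewrite pmulr_rlt0|lra].
Qed.

(** Scaled to the common mass [r * z] at [y], the mixtures differ by mass [z - r] at [x]; were this
    positive, the root would have negative excess. *)
Lemma excess2_root_max x y r z : 0 <= x -> 0 <= y -> excess1 x < 0 ->
  0 <= r -> 0 <= z -> excess2 1 x r y = 0 -> excess2 1 x z y <= 0 -> z <= r.
Proof.
move=> x0 y0 ex r0 z0 e0 ez; rewrite leNgt; apply/negP => rz.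
have zp : 0 < z by exact: le_lt_trans rz.
have [r00|rn0] := eqVneq r 0.
  by move: e0; rewrite r00 excess2_0 => h; rewrite h ltxx in ex.
have rp : 0 < r by rewrite lt_neqAle eq_sym rn0.
have h : excess2 (r + (z - r)) x (r * z) y < 0.
  apply: excess2_toward; rewrite ?mulr_ge0 ?subr_gt0 ?addr_gt0 ?mulr_gt0//.
  by rewrite -[X in excess2 X]mulr1 excess2Z// pmulr_rle0.
have : excess2 (z * 1) x (z * r) y < 0 by rewrite mulr1 mulrC; rewrite addrC subrK in h.
by rewrite excess2Z// e0 mulr0 ltxx.
Qed.

Lemma excess2_root_gt0 x y r : excess1 x < 0 -> 0 <= r ->
  excess2 1 x r y = 0 -> 0 < r.
Proof.
move=> ex r0 e0; rewrite lt_neqAle r0 andbT; apply/eqP => r00.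
by move: e0; rewrite -r00 excess2_0 => h; rewrite h ltxx in ex.
Qed.

(* In the plane of the first two moments the states lie on a parabola, so
   the diagonals [y1 x1] and [y2 x2] cross while the zeros on the sides
   [x1 y2] and [x2 y1] are joined by a segment of nonpositive excess; it cuts
   the two diagonals at points whose weight ratios multiply to [r12 * r21].
   The [c] are Lagrange weights: [c1 h(y1) + c3 h(x1) = c2 h(y2) + c4 h(x2)]
   for all quadratic [h]. *)
Lemma excess2_ratio_submodular (y1 y2 x1 x2 r11 r12 r21 r22 : R) :
  0 <= y1 -> y1 < y2 -> y2 < x1 -> x1 < x2 ->
  excess1 x1 < 0 -> excess1 x2 < 0 ->
  0 <= r11 -> 0 <= r12 -> 0 <= r21 -> 0 <= r22 ->
  excess2 1 x1 r11 y1 = 0 -> excess2 1 x1 r12 y2 = 0 ->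
  excess2 1 x2 r21 y1 = 0 -> excess2 1 x2 r22 y2 = 0 ->
  r12 * r21 <= r11 * r22.
Proof.
move=> y10 y12 yx x12 ex1 ex2 r110 r120 r210 r220 e11 e12 e21 e22.
have y20 : 0 <= y2 by lra.
have x10 : 0 <= x1 by lra.
have x20 : 0 <= x2 by lra.
have r12p := excess2_root_gt0 _ _ _ ex1 r120 e12.
have r21p := excess2_root_gt0 _ _ _ ex2 r210 e21.
pose c1 := (x1 - y2) * (x2 - y2) * (x2 - x1).
pose c2 := (x1 - y1) * (x2 - y1) * (x2 - x1).
pose c3 := (y2 - y1) * (x2 - y1) * (x2 - y2).
pose c4 := (y2 - y1) * (x1 - y1) * (x1 - y2).
have c10 : 0 < c1 by rewrite !mulr_gt0 ?subr_gt0//; lra.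
have c20 : 0 < c2 by rewrite !mulr_gt0 ?subr_gt0//; lra.
have c30 : 0 < c3 by rewrite !mulr_gt0 ?subr_gt0//; lra.
have c40 : 0 < c4 by rewrite !mulr_gt0 ?subr_gt0//; lra.
pose D1 := c2 + c3 * r12; pose D2 := c1 + c4 * r21.
have D10 : 0 < D1 by apply: addr_gt0 => //; apply: mulr_gt0.
have D20 : 0 < D2 by apply: addr_gt0 => //; apply: mulr_gt0.
have z1 : r12 * D2 / D1 <= r11.
  apply: (excess2_root_max x1 y1) => //.
    by rewrite divr_ge0 ?mulr_ge0 ?(ltW D20)// ltW.
  rewrite -(pmulr_rle0 _ D10) -excess2Z ?(ltW D10)// mulr1 mulrCA divff ?gt_eqF// mulr1.
  (* The Lagrange identity, times [r12], trades mass at [y1] and [x1] for mass at [y2] and [x2].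
     What results is the sum of two scaled roots, and subadditivity bounds its excess by zero. *)
  have -> : excess2 D1 x1 (r12 * D2) y1 =
      excess (c2 + c2 * r12 + (r12 * c4 + r12 * c4 * r21))
        (c2 * x1 + c2 * r12 * y2 + (r12 * c4 * x2 + r12 * c4 * r21 * y1))
        (c2 * (x1 * (x1 + 1)) + c2 * r12 * (y2 * (y2 + 1)) +
         (r12 * c4 * (x2 * (x2 + 1)) + r12 * c4 * r21 * (y1 * (y1 + 1)))).
    by congr excess; rewrite /D1 /D2 /c1 /c2 /c3 /c4; ring.
  have p0 : 0 < r12 * c4 by exact: mulr_gt0.
  have h1 : excess2 c2 x1 (c2 * r12) y2 = 0.
    by rewrite -[X in excess2 X]mulr1 excess2Z ?e12 ?mulr0// ltW.
  have h2 : excess2 (r12 * c4) x2 (r12 * c4 * r21) y1 = 0.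
    by rewrite -[X in excess2 X]mulr1 excess2Z ?e21 ?mulr0// ltW.
  rewrite -[leRHS]addr0 -{1}h1 -h2; apply: excess2_subadd => //;
    first [exact: ltW | by apply: mulr_ge0 => //; exact: ltW
      | by apply: addr_gt0 => //; exact: mulr_gt0].
have z2 : r21 * D1 / D2 <= r22.
  apply: (excess2_root_max x2 y2) => //.
    by rewrite divr_ge0 ?mulr_ge0 ?(ltW D10)// ltW.
  rewrite -(pmulr_rle0 _ D20) -excess2Z ?(ltW D20)// mulr1 mulrCA divff ?gt_eqF// mulr1.
  have -> : excess2 D2 x2 (r21 * D1) y2 =
      excess (c1 + c1 * r21 + (r21 * c3 + r21 * c3 * r12))
        (c1 * x2 + c1 * r21 * y1 + (r21 * c3 * x1 + r21 * c3 * r12 * y2))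
        (c1 * (x2 * (x2 + 1)) + c1 * r21 * (y1 * (y1 + 1)) +
         (r21 * c3 * (x1 * (x1 + 1)) + r21 * c3 * r12 * (y2 * (y2 + 1)))).
    by congr excess; rewrite /D1 /D2 /c1 /c2 /c3 /c4; ring.
  have p0 : 0 < r21 * c3 by exact: mulr_gt0.
  have h1 : excess2 c1 x2 (c1 * r21) y1 = 0.
    by rewrite -[X in excess2 X]mulr1 excess2Z ?e21 ?mulr0// ltW.
  have h2 : excess2 (r21 * c3) x1 (r21 * c3 * r12) y2 = 0.
    by rewrite -[X in excess2 X]mulr1 excess2Z ?e12 ?mulr0// ltW.
  rewrite -[leRHS]addr0 -{1}h1 -h2; apply: excess2_subadd => //;
    first [exact: ltW | by apply: mulr_ge0 => //; exact: ltW
      | by apply: addr_gt0 => //; exact: mulr_gt0].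
have -> : r12 * r21 = (r12 * D2 / D1) * (r21 * D1 / D2).
  by field; rewrite !gt_eqF.
by apply: ler_pM => //; rewrite divr_ge0 ?mulr_ge0 ?(ltW D10) ?(ltW D20).
Qed.

Lemma excess2_root_exists x y : 0 <= x -> 0 <= y -> excess1 x < 0 -> 0 <= excess1 y ->
  exists2 g, 0 <= g < 1 & excess2 g x (1 - g) y = 0.
Proof.
move=> x0 y0 ex ey; pose f g := excess2 g x (1 - g) y.
have f0 : f 0 = excess1 y by rewrite /f subr0 excess2C excess2_0.
have f1 : f 1 = excess1 x by rewrite /f subrr excess2_0.
have cf : continuous f.
  move=> g.
  have cB : {for g, continuous (fun g : R => g * (x * (x + 1)) + (1 - g) * (y * (y + 1)))}.
    by apply: cvgD; apply: cvgMl; [exact: cvg_id|apply: cvgB; [exact: cvg_cst|exact: cvg_id]].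
  have cA : {for g, continuous (fun g : R => g * x + (1 - g) * y)}.
    by apply: cvgD; apply: cvgMl; [exact: cvg_id|apply: cvgB; [exact: cvg_cst|exact: cvg_id]].
  have cT : {for g, continuous (fun g : R => g + (1 - g))}.
    by apply: cvgD; [exact: cvg_id|apply: cvgB; [exact: cvg_cst|exact: cvg_id]].
  apply: cvgB; first by apply: cvgB => //; apply: cvgMr.
  apply: cvgMr; apply: (continuous_comp _ _); last exact: sqrt_continuous.
  by apply: cvgB; [exact: cvgM|rewrite expr2; exact: cvgM].
have [||g /[!in_itv]/= /andP[g0 g1] fg] := @IVT R f 0 1 0 ler01.
- exact: continuous_subspaceT.
- by rewrite f0 f1 ge_min le_max (ltW ex) ey orbT.
exists g => //; rewrite g0 lt_neqAle g1 andbT; apply/eqP => g1E.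
by move: fg; rewrite g1E f1 => h; rewrite h ltxx in ex.
Qed.

(* By convexity, since the excess vanishes at [g] and is negative at [1]. *)
Lemma excess2_ge0_le_root x y g h : 0 <= x -> 0 <= y -> excess1 x < 0 ->
  0 <= g < 1 -> excess2 g x (1 - g) y = 0 -> 0 <= h <= 1 ->
  (0 <= excess2 h x (1 - h) y) = (h <= g).
Proof.
move=> x0 y0 ex /andP[g0 g1] eg /andP[h0 h1].
have [hg|gh] := leP h g; last first.
  apply/negbTE; rewrite -ltNge.
  rewrite -(pmulr_rlt0 _ (_ : 0 < 1 - g)) ?subr_gt0// -excess2Z; last by lra.
  (* Scaled to the common mass [(1 - g) * (1 - h)] at [y], the two mixtures differ by mass [h - g]
     at [x]; for [h = 1] the common mass vanishes, hence the separate case. *)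
  have -> : (1 - g) * h = (1 - h) * g + (h - g) by ring.
  have h1' : 0 <= 1 - h by rewrite subr_ge0.
  have g1' : 0 < 1 - g by rewrite subr_gt0.
  have e0 : excess2 ((1 - h) * g) x ((1 - g) * (1 - h)) y <= 0.
    by rewrite [(1 - g) * _]mulrC excess2Z// eg mulr0.
  have [hE|hn] := eqVneq h 1.
    rewrite hE subrr mul0r mulr0 add0r -[X in excess2 X]mulr1.
    rewrite -[X in excess2 _ _ X](mulr0 (1 - g)) excess2Z ?(ltW g1')//.
    by rewrite excess2_0 pmulr_rlt0.
  have hp : 0 < 1 - h by rewrite subr_gt0 lt_neqAle hn.
  apply: excess2_toward => //; rewrite ?subr_gt0//.
  - by rewrite mulr_ge0.
  - by rewrite mulr_ge0// ltW.
  - by rewrite ltr_wpDl ?mulr_ge0// mulr_gt0.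
rewrite leNgt; apply/negP => eh.
have [gE|gn] := eqVneq h g; first by rewrite gE eg ltxx in eh.
have hg' : h < g by rewrite lt_neqAle gn.
have : excess2 ((1 - g) * h + (g - h)) x ((1 - g) * (1 - h)) y < 0.
  have g1' : 0 < 1 - g by rewrite subr_gt0.
  apply: excess2_toward => //; rewrite ?subr_gt0//.
  - by rewrite mulr_ge0// ltW.
  - by rewrite mulr_ge0 ?subr_ge0// ltW.
  - by rewrite -mulrDr [h + _]addrC subrK mulr1.
  - by rewrite excess2Z ?(ltW g1')// pmulr_rle0// ltW.
have -> : (1 - g) * h + (g - h) = (1 - h) * g by ring.
by rewrite [(1 - g) * _]mulrC excess2Z ?eg ?mulr0 ?ltxx//; lra.
Qed.

Definition mean2 (g x y : R) := g * x + (1 - g) * y.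
(** A two-point law on [y] and [x] of mean [m] has variance [(x - m) * (m - y)]. In this form,
    chords that share a mean compare at once. *)
Definition var2 (g x y : R) :=
  mean2 g x y + (x - mean2 g x y) * (mean2 g x y - y).

Lemma excess2_mean_var g x y :
  excess2 g x (1 - g) y = tau - mean2 g x y - beta * Num.sqrt (var2 g x y).
Proof.
rewrite /excess2 /excess dispersion [g + _]addrC subrK mulr1 mul1r.
by congr (_ - _ * Num.sqrt _); rewrite /var2 /mean2; ring.
Qed.

Lemma nested_moments (yo yi xi xo go gi : R) :
  0 <= yo -> yo <= yi -> yi <= xi -> xi <= xo ->
  0 <= go <= 1 -> 0 <= gi <= 1 ->
  excess2 go xo (1 - go) yo = 0 -> excess2 gi xi (1 - gi) yi = 0 ->
  excess1 xi < 0 \/ (excess1 xi <= 0 /\ yi = xi) ->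
  mean2 go xo yo <= mean2 gi xi yi /\ var2 gi xi yi <= var2 go xo yo.
Proof.
move=> yo0 yoi yxi xio /andP[go0 go1] /andP[gi0 gi1] eo ei ex.
have xi0 : 0 <= xi by lra.
have yi0 : 0 <= yi by lra.
have exi : excess1 xi <= 0 by case: ex => [/ltW//|[]].
have io1 : yo <= mean2 go xo yo by rewrite /mean2; nra.
have io2 : mean2 go xo yo <= xo by rewrite /mean2; nra.
have ii1 : yi <= mean2 gi xi yi by rewrite /mean2; nra.
have ii2 : mean2 gi xi yi <= xi by rewrite /mean2; nra.
have vo : mean2 go xo yo <= var2 go xo yo.
  by rewrite /var2 lerDl mulr_ge0 ?subr_ge0.
have mono : mean2 go xo yo <= mean2 gi xi yi.
  rewrite leNgt; apply/negP => mio.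
  (* A mean beyond [xi] is impossible: the variance is at least the mean, so the excess is at most
     that of a single state with this mean, which is negative. *)
  have [Ax|xA] := leP (mean2 go xo yo) xi; last first.
    have := excess1_decr _ _ xA.
    have := ler_wpM2l beta_ge0 (ler_wsqrtr vo).
    by move: eo; rewrite excess2_mean_var /excess1; rewrite /excess1 in exi; lra.
  have yxn : yi < xi by lra.
  have {}ex : excess1 xi < 0 by case: ex => // -[_ yE]; rewrite yE ltxx in yxn.
  (* The point of the inner chord with the outer mean. It lies past the root [gi], so its excess is
     negative; yet its variance is at most the outer one, whose excess is zero. *)
  pose h := (mean2 go xo yo - yi) / (xi - yi).
  have hE : mean2 h xi yi = mean2 go xo yo.
    rewrite {1}/mean2 /h; field; lra.
  have h01 : 0 <= h <= 1.
    by rewrite divr_ge0 ?ler_pdivrMr; lra.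
  have gi1' : gi < 1.
    rewrite lt_neqAle gi1 andbT; apply/eqP => g1; move: ei.
    by rewrite g1 subrr excess2_0 => e; rewrite e ltxx in ex.
  have gih : gi < h.
    rewrite /h ltr_pdivlMr ?subr_gt0//.
    by move: mio; rewrite {1}/mean2; lra.
  have := excess2_ge0_le_root xi yi gi h xi0 yi0 ex.
  rewrite gi0 gi1' ei h01 => /(_ isT erefl isT).
  rewrite (leNgt h) gih /= => /negbT; rewrite -ltNge excess2_mean_var.
  have : var2 h xi yi <= var2 go xo yo.
    by rewrite /var2 hE lerD2l; apply: ler_pM; lra.
  move=> /ler_wsqrtr /(ler_wpM2l beta_ge0).
  by move: eo; rewrite excess2_mean_var hE; lra.
split=> //.
move: eo ei; rewrite !excess2_mean_var => eo ei.
(* For [beta = 0] the utility does not see the variance; the means then coincide and the chords are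
   compared directly. *)
have [b0|bn0] := eqVneq beta 0.
  have mE : mean2 gi xi yi = mean2 go xo yo by move: eo ei; rewrite b0 !mul0r; lra.
  rewrite /var2 mE in ii1 ii2 *.
  by rewrite lerD2l; apply: ler_pM; lra.
have bp : 0 < beta by rewrite lt_neqAle eq_sym bn0.
have h : Num.sqrt (var2 gi xi yi) <= Num.sqrt (var2 go xo yo).
  by rewrite -(ler_pM2l bp); lra.
have Vo : 0 <= var2 go xo yo by apply: le_trans vo; lra.
have Vi : 0 <= var2 gi xi yi.
  by rewrite /var2 addr_ge0 ?mulr_ge0 ?subr_ge0//; lra.
by rewrite -(sqr_sqrtr Vo) -(sqr_sqrtr Vi) !expr2 ler_pM ?sqrtr_ge0.
Qed.

End excess.

(* Locked, since unification may otherwise unfold them to Lebesgue integrals. *)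
HB.lock Definition utility {R : realType} {C : nat} (tau beta : R) (n : 'I_C) : R :=
  rho tau beta (point_mass n).
HB.lock Definition weight {R : realType} {C : nat} (tau beta : R) (n m : 'I_C) : R :=
  gamma tau beta n m.

(** * Utilities, weights and pairing ratios of states *)

Section customer_utility.
Context {R : realType} {C : nat}.
Variables (tau beta : R).
Hypothesis beta_ge0 : 0 <= beta.
Implicit Types (n m : 'I_C) (mu : 'rV[R]_C).

Definition wait n : R := n.+1%:R.

Local Notation u n := (utility tau beta n).
Local Notation weight := (weight tau beta).

Lemma wait_ge0 n : 0 <= wait n. Proof. exact: ler0n. Qed.

Lemma wait_lt n m : (n < m)%N -> wait n < wait m.
Proof. by rewrite ltr_nat. Qed.

Lemma wait_le n m : (n <= m)%N -> wait n <= wait m.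
Proof. by rewrite ler_nat. Qed.

Lemma segmentE g n m w :
  segment g n m 0 w = g * (w == n)%:R + (1 - g) * (w == m)%:R :> R.
Proof. by rewrite !mxE /= . Qed.

Lemma sum_segment g n m (f : 'I_C -> R) :
  \sum_w segment g n m 0 w * f w = g * f n + (1 - g) * f m.
Proof.
have sum1 (k : 'I_C) (c : R) : \sum_w c * (w == k)%:R * f w = c * f k.
  rewrite (bigD1 k)//= eqxx mulr1 big1 ?addr0// => w /negbTE ->.
  by rewrite mulr0 mul0r.
by under eq_bigr do rewrite segmentE mulrDl; rewrite big_split/= !sum1.
Qed.

Lemma sum_segment1 g n m : \sum_w segment g n m 0 w = 1 :> R.
Proof.
under eq_bigr do rewrite -[segment _ _ _ _ _]mulr1.
by rewrite sum_segment !mulr1 addrC subrK.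
Qed.

Lemma segment_simplex g n m : 0 <= g <= 1 -> simplex (segment g n m : 'rV[R]_C).
Proof.
move=> /andP[g0 g1]; split=> [w|].
  by rewrite segmentE addr_ge0// mulr_ge0 ?subr_ge0.
exact: sum_segment1.
Qed.

Lemma point_massE n : point_mass n = segment 1 n n :> 'rV[R]_C.
Proof. by rewrite /segment scale1r subrr scale0r addr0. Qed.

Lemma segment_diag g n : segment g n n = point_mass n :> 'rV[R]_C.
Proof. by rewrite /segment -scalerDl addrC subrK scale1r. Qed.

Lemma rho_simplex mu : simplex mu ->
  rho tau beta mu = excess tau beta 1 (moment1 mu) (moment2 mu).
Proof.
move=> mus; rewrite /rho mean_wait_simplex// var_wait_simplex// /excess !mulr1.
by rewrite opprD addrA.
Qed.

Lemma moment1_segment g n m :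
  moment1 (segment g n m) = mean2 g (wait n) (wait m).
Proof. exact: sum_segment. Qed.

Lemma moment2_segment g n m : moment2 (segment g n m) =
  g * (wait n * (wait n + 1)) + (1 - g) * (wait m * (wait m + 1)).
Proof.
rewrite /moment2 (sum_segment _ _ _ (fun w => w.+1%:R * w.+2%:R)).
by rewrite /wait !natr1.
Qed.

Lemma rho_segment g n m : 0 <= g <= 1 ->
  rho tau beta (segment g n m) = excess2 tau beta g (wait n) (1 - g) (wait m).
Proof.
move=> g01; rewrite rho_simplex; last exact: segment_simplex.
by rewrite moment1_segment moment2_segment /excess2 [g + _]addrC subrK.
Qed.

Lemma mean_wait_segment g n m : 0 <= g <= 1 ->
  mean_wait (segment g n m) = mean2 g (wait n) (wait m).
Proof.
by move=> g01; rewrite mean_wait_simplex ?moment1_segment//; exact: segment_simplex.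
Qed.

Lemma var_wait_segment g n m : 0 <= g <= 1 ->
  var_wait (segment g n m) = var2 g (wait n) (wait m).
Proof.
move=> g01; rewrite var_wait_simplex; last exact: segment_simplex.
by rewrite moment1_segment moment2_segment /var2 /mean2; ring.
Qed.

Lemma rho_point_mass n : rho tau beta (point_mass n) = u n.
Proof. by rewrite utility.unlock. Qed.

Lemma utilityE n : u n = excess1 tau beta (wait n).
Proof.
rewrite -rho_point_mass point_massE rho_segment ?ler01 ?lexx//.
by rewrite excess2_diag// addrC subrK.
Qed.

Lemma L0P n : L0 tau beta n <-> u n < 0.
Proof. by rewrite -rho_point_mass. Qed.

Lemma K1P n : K1 tau beta n <-> 0 <= u n.
Proof. by rewrite -rho_point_mass. Qed.

Lemma utility_decr n m : (n < m)%N -> u m < u n.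
Proof. by move=> nm; rewrite !utilityE excess1_decr// wait_lt. Qed.

Lemma utility_sign_lt n m : u n < 0 -> 0 <= u m -> (m < n)%N.
Proof.
move=> ln km; rewrite ltnNge leq_eqVlt; apply/negP => /orP[/eqP/val_inj nm|/utility_decr nm].
  by move: ln; rewrite nm ltNge km.
by have := lt_le_trans (lt_trans nm ln) km; rewrite ltxx.
Qed.

(** By [excess2_ge0_le_root], the set whose supremum defines [gamma] is the interval from 0 to the
    root. *)
Lemma weight_spec n m : u n < 0 -> 0 <= u m ->
  0 <= weight n m < 1 /\
  excess2 tau beta (weight n m) (wait n) (1 - weight n m) (wait m) = 0.
Proof.
rewrite !utilityE => ln km.
have [g g01 eg] := excess2_root_exists _ _ _ _ (wait_ge0 n) (wait_ge0 m) ln km.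
suff -> : weight n m = g by [].
rewrite weight.unlock /gamma -[RHS](@sup_itvcc _ 0); last by case/andP: g01.
congr sup; apply/seteqP; split => h /=; rewrite in_itv/=.
  move=> [h01 [_]]; rewrite rho_segment// (excess2_ge0_le_root _ _ _ _ _ g)//;
    try exact: wait_ge0.
  by move=> ->; case/andP: h01 => ->.
move=> /andP[h0 hg].
have h01 : 0 <= h <= 1 by rewrite h0 (le_trans hg)// ltW//; case/andP: g01.
split=> //; split; first exact: segment_simplex.
by rewrite rho_segment// (excess2_ge0_le_root _ _ _ _ _ g)//; exact: wait_ge0.
Qed.

Lemma chiE n m : chi tau beta n m = segment (weight n m) n m.
Proof. by rewrite weight.unlock. Qed.

Lemma weight_gt0 n m : u n < 0 -> 0 < u m -> 0 < weight n m.
Proof.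
move=> ln km; have [/andP[g0 g1] eg] := weight_spec _ _ ln (ltW km).
rewrite lt_neqAle g0 andbT; apply/eqP => gE; move: eg.
by rewrite -gE subr0 excess2C excess2_0 -utilityE => h; rewrite h ltxx in km.
Qed.

(** Hence [chi] is then the point mass at [m], and pairings can be confined to columns of positive
    utility, where [pairing_ratio] does not divide by zero. *)
Lemma weight_eq0 n m : u n < 0 -> u m = 0 -> weight n m = 0.
Proof.
move=> ln km; have k1m : 0 <= u m by rewrite km.
have [/andP[g0 g1] eg] := weight_spec _ _ ln k1m.
apply/eqP; rewrite eq_le g0 andbT leNgt; apply/negP => gp.
have : excess2 tau beta (0 + weight n m) (wait n) (1 - weight n m) (wait m) < 0.
  apply: excess2_toward; rewrite ?wait_ge0 ?add0r ?subr_ge0 ?subr_gt0 ?(ltW g1)//.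
    by rewrite -utilityE.
  rewrite -[X in excess2 _ _ _ _ X]mulr1 -[X in excess2 _ _ X](mulr0 (1 - weight n m)).
  by rewrite excess2Z ?subr_ge0 ?(ltW g1)// excess2C excess2_0 -utilityE km mulr0.
by rewrite add0r eg ltxx.
Qed.

Definition pairing_ratio n m : R := (1 - weight n m) / weight n m.

Lemma ratio_gt0 n m : u n < 0 -> 0 < u m -> 0 < pairing_ratio n m.
Proof.
move=> ln km; have [/andP[g0 g1] _] := weight_spec _ _ ln (ltW km).
by rewrite divr_gt0 ?subr_gt0// weight_gt0.
Qed.

Lemma ratio_root n m : u n < 0 -> 0 < u m ->
  excess2 tau beta 1 (wait n) (pairing_ratio n m) (wait m) = 0.
Proof.
move=> ln km; have [_ eg] := weight_spec _ _ ln (ltW km).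
have gp := weight_gt0 _ _ ln km.
apply/eqP; rewrite -(mulrI_eq0 _ (mulfI (lt0r_neq0 gp))) -excess2Z ?ltW//.
by rewrite mulr1 /pairing_ratio mulrC divfK ?lt0r_neq0// eg.
Qed.

Lemma ratio_submodular n1 n2 m1 m2 : (m1 < m2)%N -> (n1 < n2)%N ->
  u n1 < 0 -> u n2 < 0 -> 0 < u m1 -> 0 < u m2 ->
  pairing_ratio n1 m2 * pairing_ratio n2 m1 <= pairing_ratio n1 m1 * pairing_ratio n2 m2.
Proof.
move=> m12 n12 l1 l2 k1 k2.
have mn := wait_lt _ _ (utility_sign_lt _ _ l1 (ltW k2)).
apply: (@excess2_ratio_submodular _ tau beta _ (wait m1) (wait m2) (wait n1) (wait n2));
  first [exact: beta_ge0 | exact: wait_ge0 | exact: wait_lt | exact: mn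
    | exact: ratio_root | exact/ltW/ratio_gt0 | by rewrite -utilityE].
Qed.

(** The gap is the variance of the mean wait of the random state. *)
Lemma variance_ge_mean mu : simplex mu ->
  moment1 mu <= moment2 mu - moment1 mu ^+ 2.
Proof.
move=> [mu0 mu1]; set A := moment1 mu.
suff : 0 <= \sum_n mu 0 n * (n.+1%:R - A) ^+ 2.
  have -> : \sum_n mu 0 n * (n.+1%:R - A) ^+ 2 =
      \sum_n (mu 0 n * (n.+1%:R * n.+2%:R) - (1 + 2 * A) * (mu 0 n * n.+1%:R) +
        A ^+ 2 * mu 0 n).
    by apply: eq_bigr => n _; rewrite -natr1; ring.
  rewrite big_split/= sumrB -!mulr_sumr mu1 -/(moment1 mu) -/(moment2 mu) -/A.
  lra.
by apply: sumr_ge0 => n _; rewrite mulr_ge0 ?sqr_ge0.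
Qed.

(** Both mean and variance are at least the mean wait of the least state in the support, so the
    utility is at most that of this state. This makes a single leave signal obedient. *)
Lemma rho_le0_on_L0 mu : simplex mu ->
  (forall n, mu 0 n != 0 -> u n < 0) -> rho tau beta mu <= 0.
Proof.
move=> mus suppL; have [mu0 mu1] := mus.
have [n0 n0P] : exists n, mu 0 n != 0.
  apply/existsP; apply: contraT; rewrite negb_exists => /forallP mu00.
  have := mu1; rewrite big1 => [/esym/eqP|n _]; first by rewrite oner_eq0.
  by have := mu00 n; rewrite negbK => /eqP.
pose k := [arg min_(i < n0 | mu 0 i != 0) val i].
have [kP kmin] : mu 0 k != 0 /\ forall i, mu 0 i != 0 -> (k <= i)%N.
  by rewrite /k; case: arg_minnP.
have kA : wait k <= moment1 mu.
  rewrite -[wait k]mul1r -mu1 mulr_suml; apply: ler_sum => i _.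
  have [->|i0] := eqVneq (mu 0 i) 0; first by rewrite !mul0r.
  by rewrite ler_wpM2l// wait_le// kmin.
rewrite rho_simplex// /excess !mulr1.
have := suppL _ kP; rewrite utilityE /excess1.
have := ler_wpM2l beta_ge0 (ler_wsqrtr (le_trans kA (variance_ge_mean _ mus))).
lra.
Qed.

End customer_utility.

(** * The linear program *)

(** The missing mass goes to an extra point 0, which also replaces the points of zero
    coefficient. *)
Lemma convex_hull_fin {R : realType} {C : nat} (A : set 'rV[R]_C) (I : finType)
    (c : I -> R) (y : I -> 'rV[R]_C) :
  A 0 -> (forall i, 0 <= c i) -> \sum_i c i <= 1 ->
  (forall i, c i != 0 -> A (y i)) -> convex_hull A (\sum_i c i *: y i).
Proof.
move=> A0 c0 c1 Ay.
pose c' (i : 'I_#|I|.+1) :=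
  if unlift ord0 i is Some j then c (enum_val j) else 1 - \sum_i c i.
pose y' (i : 'I_#|I|.+1) :=
  if unlift ord0 i is Some j then
    (if c (enum_val j) == 0 then 0 else y (enum_val j)) else 0.
exists #|I|.+1, c', y'; split.
- move=> i; rewrite /c'; case: unliftP => [j _|_]; first exact: c0.
  by rewrite subr_ge0.
- rewrite big_ord_recl {1}/c' unlift_none (eq_bigr (fun j => c (enum_val j))).
    by rewrite -(big_enum_val c) subrK.
  by move=> j _; rewrite /c' liftK.
- move=> i; rewrite /y'; case: unliftP => [j _|_]//.
  by case: eqVneq => // /Ay.
pose cy i := c i *: (if c i == 0 then 0 else y i).
rewrite big_ord_recl {1}/y' unlift_none scaler0 add0r.
rewrite [RHS](eq_bigr (fun j => cy (enum_val j))); last first.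
  by move=> j _; rewrite /c' /y' liftK.
rewrite -(big_enum_val cy) /cy; apply: eq_bigr => i _; case: eqVneq => // ->.
by rewrite !scale0r.
Qed.

Lemma sum_rowC {R : realType} {C : nat} (I : finType) (c : I -> R)
    (y : I -> 'rV[R]_C) :
  \sum_w (\sum_i c i *: y i) 0 w = \sum_i c i * \sum_w y i 0 w.
Proof.
under eq_bigr do rewrite summxE.
rewrite exchange_big /=; apply: eq_bigr => i _.
by rewrite mulr_sumr; apply: eq_bigr => w _; rewrite mxE.
Qed.

(** Summing the recursion, the mass at state 0 plus [lam] times the throughput is 1. Without mass at
    state 0, the recursion would give zero everywhere. *)
Lemma throughput_lt1 {R : realType} {C : nat} (hC : (0 < C)%N) (lam : R)
    (t0 t1 : 'rV[R]_C) :
  (forall w, 0 <= t0 0 w) -> (forall w, 0 <= t1 0 w) ->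
  (forall w w' : 'I_C, w' = w.+1 :> nat -> t0 0 w' + t1 0 w' = lam * t1 0 w) ->
  \sum_w t0 0 w + \sum_w t1 0 w + lam * t1 0 (last_state hC) = 1 ->
  lam * \sum_w t1 0 w < 1.
Proof.
case: C hC t0 t1 => // k hk t0 t1 t00 t10 rec tot.
have recl (i : 'I_k) : t0 0 (lift ord0 i) + t1 0 (lift ord0 i) =
    lam * t1 0 (widen_ord (leqnSn k) i) by exact: rec.
have p0E : t0 0 ord0 + t1 0 ord0 + lam * \sum_w t1 0 w = 1.
  rewrite -tot -big_split/= [in RHS]big_ord_recl [in LHS]big_ord_recr/=.
  rewrite (eq_bigr _ (fun i _ => recl i)) -mulr_sumr mulrDr !addrA.
  by congr (_ + lam * t1 0 _); exact: val_inj.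
suff : 0 < t0 0 ord0 + t1 0 ord0 by lra.
rewrite lt_neqAle addr_ge0// andbT; apply/eqP => /esym p00.
have all0 j : forall w : 'I_k.+1, w = j :> nat -> t0 0 w + t1 0 w = 0.
  elim: j => [|j IH] w wj; first by rewrite (_ : w = ord0)//; exact: val_inj.
  have jk : (j < k.+1)%N by rewrite ltnW// -wj.
  rewrite (rec (Ordinal jk))//; have := IH (Ordinal jk) erefl.
  have := t00 (Ordinal jk); have := t10 (Ordinal jk) => *.
  by rewrite (_ : t1 0 _ = 0) ?mulr0//; lra.
move: p0E; rewrite p00 add0r big1 ?mulr0 => [/esym/eqP|w _]; first by rewrite oner_eq0.
by have := all0 w w erefl; have := t00 w; have := t10 w; lra.
Qed.

Section program.
Context {R : realType} {C : nat}.
Variables (hC : (0 < C)%N) (lam tau beta : R).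
Hypotheses (lam_gt0 : 0 < lam) (beta_ge0 : 0 <= beta).
Implicit Types (n m w : 'I_C) (t v : 'rV[R]_C) (x : 'I_C -> 'I_C -> R).

Local Notation u n := (utility tau beta n).
Local Notation L n := (u n < 0).
Local Notation K n := (0 < u n).
Local Notation flow := (supported_flow (fun n => L n) (fun m => K m)).
Local Notation ratio := (pairing_ratio tau beta).

(* [x n m] is the part of the mass at [n] that is paired with state [m]. *)
Definition pairing v x : Prop :=
  [/\ flow x, forall n, L n -> v 0 n = \sum_m x n m
    & forall m, ~~ L m -> \sum_n ratio n m * x n m <= v 0 m].

Lemma flow_ge0 x n m : flow x -> 0 <= x n m.
Proof. by move=> /(_ n m) []. Qed.

Lemma flow_notL x n m : flow x -> ~~ L n -> x n m = 0.
Proof. by move=> /(_ n m) [_ h] Ln; apply/eqP; apply: contraT => /h [/(negP Ln)]. Qed.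

Lemma flow_notK x n m : flow x -> ~~ K m -> x n m = 0.
Proof. by move=> /(_ n m) [_ h] Km; apply/eqP; apply: contraT => /h [_ /(negP Km)]. Qed.

Lemma ratio_flow_ge0 x n m : flow x -> 0 <= ratio n m * x n m.
Proof.
move=> fx; have [->|xn] := eqVneq (x n m) 0; first by rewrite mulr0.
have [x0 /(_ xn) [ln km]] := fx n m.
by rewrite mulr_ge0// ltW// ratio_gt0.
Qed.

Lemma pairing_ge0 v x w : pairing v x -> 0 <= v 0 w.
Proof.
move=> [fx xr xc]; have [lw|lw] := boolP (L w).
  by rewrite xr//; apply: sumr_ge0 => m _; exact: flow_ge0.
by apply: le_trans (xc _ lw); apply: sumr_ge0 => n _; exact: ratio_flow_ge0.
Qed.

Lemma pairing0 : pairing 0 (fun _ _ => 0).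
Proof.
split=> [n m|n _|m _]; first by rewrite eqxx.
  by rewrite mxE big1.
by rewrite mxE big1// => n _; rewrite mulr0.
Qed.

Lemma pairingD v1 v2 x1 x2 : pairing v1 x1 -> pairing v2 x2 ->
  pairing (v1 + v2) (fun n m => x1 n m + x2 n m).
Proof.
move=> [f1 r1 c1] [f2 r2 c2]; split=> [n m|n ln|m lm].
- have [x10 h1] := f1 n m; have [x20 h2] := f2 n m; split; first exact: addr_ge0.
  have [->|/h1//] := eqVneq (x1 n m) 0; rewrite add0r; exact: h2.
- by rewrite mxE big_split/= r1// r2.
- under eq_bigr do rewrite mulrDr.
  by rewrite mxE big_split/= lerD ?c1 ?c2.
Qed.

Lemma pairingZ c v x : 0 <= c -> pairing v x ->
  pairing (c *: v) (fun n m => c * x n m).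
Proof.
move=> c0 [fx rx cx]; split=> [n m|n ln|m lm].
- have [x0 h] := fx n m; split; first exact: mulr_ge0.
  by rewrite mulf_eq0 negb_or => /andP[_ /h].
- by rewrite mxE -mulr_sumr rx.
- under eq_bigr do rewrite mulrCA.
  by rewrite mxE -mulr_sumr ler_wpM2l// cx.
Qed.

Lemma pairing_point_mass m : ~~ L m -> pairing (point_mass m) (fun _ _ => 0).
Proof.
move=> lm; split=> [n k|n ln|k lk]; first by rewrite eqxx.
  have nm : (n == m) = false by apply/negbTE/eqP => nm; move: lm; rewrite -nm ln.
  by rewrite big1// /point_mass mxE /= nm.
by rewrite big1 ?mxE// => i _; rewrite mulr0.
Qed.

Definition single n m (e : R) : 'I_C -> 'I_C -> R :=
  fun i j => if (i == n) && (j == m) then e else 0.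

Lemma sum_single_row n m e i : \sum_j single n m e i j = e * (i == n)%:R.
Proof.
rewrite /single; case: (i == n) => /=; last by rewrite big1 ?mulr0.
by rewrite -big_mkcond big_pred1_eq mulr1.
Qed.

Lemma sum_single_col n m e j (f : 'I_C -> R) :
  \sum_i f i * single n m e i j = f n * e * (j == m)%:R.
Proof.
rewrite /single (bigD1 n)//= eqxx /= big1 ?addr0.
  by case: eqP => _; rewrite ?mulr1 ?mulr0.
by move=> i /negbTE ->; rewrite mulr0.
Qed.

Lemma flow_single n m e : L n -> K m -> 0 <= e -> flow (single n m e).
Proof.
move=> ln km e0 i j; rewrite /single; case: ifP => [/andP[/eqP -> /eqP ->]|_].
  by split=> [|_]; [exact: e0 | split; [exact: ln | exact: km]].
by rewrite eqxx.
Qed.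

Lemma pairing_chi n m : L n -> K m ->
  pairing (chi tau beta n m) (single n m (weight tau beta n m)).
Proof.
move=> ln km; have gp : 0 < weight tau beta n m by exact: weight_gt0.
split=> [|i li|j lj].
- exact: (flow_single _ _ _ ln km (ltW gp)).
- have im : (i == m) = false.
    by apply/negbTE/eqP => im; move: (lt_trans li km); rewrite im ltxx.
  by rewrite sum_single_row chiE segmentE im mulr0 addr0.
- rewrite sum_single_col chiE segmentE; have [->|jm] := eqVneq j m.
    rewrite /pairing_ratio divfK; last by rewrite gt_eqF.
    by rewrite mulr1 lerDr; apply: mulr_ge0; [exact: ltW|exact: ler0n].
  by rewrite !mulr0 addr0; apply: mulr_ge0; [exact: ltW|exact: ler0n].
Qed.

(** Pairings add and scale, so it suffices to pair each generator. *)
Lemma hull_pairing t : convex_hull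
    ((point_mass @` K1 tau beta) `|` K01 tau beta `|` [set 0]) t ->
  (exists x, pairing t x) /\ \sum_w t 0 w <= 1.
Proof.
move=> [k [c [y [c0 c1 yA ->]]]].
have gen i : (exists x, pairing (y i) x) /\ \sum_w y i 0 w <= 1.
  have pm m : \sum_w (point_mass m : 'rV[R]_C) 0 w = 1.
    by rewrite point_massE sum_segment1.
  have pe m : K1 tau beta m -> (exists x, pairing (point_mass m) x) /\
      \sum_w (point_mass m : 'rV[R]_C) 0 w <= 1.
    move=> km; rewrite pm; split=> //; exists (fun _ _ => 0).
    by apply: pairing_point_mass; rewrite -leNgt; move/K1P: km.
  have [[[m km <-]|[n [m [ln km ->]]]]|->] := yA i; first exact: pe.
    move/L0P in ln; have := (K1P _ _ _).1 km.
    rewrite le_eqVlt => /orP[/eqP/esym um|um].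
      by rewrite chiE weight_eq0// /segment scale0r add0r subr0 scale1r; exact: pe.
    split; first by eexists; exact: pairing_chi.
    by rewrite chiE sum_segment1.
  split; first by eexists; exact: pairing0.
  by rewrite big1 ?ler01// => w _; rewrite mxE.
split; last first.
  rewrite sum_rowC -c1; apply: ler_sum => i _.
  by rewrite ler_piMr//; case: (gen i).
elim/big_ind: _ => [|v1 v2 [x1 p1] [x2 p2]|i _].
- by eexists; exact: pairing0.
- by eexists; exact: pairingD p1 p2.
- by have [[x px] _] := gen i; eexists; exact: pairingZ (c0 i) px.
Qed.

Lemma pairing_hull t x : pairing t x -> \sum_w t 0 w <= 1 -> convex_hull
    ((point_mass @` K1 tau beta) `|` K01 tau beta `|` [set 0]) t.
Proof.
move=> px t1; have [fx rx cx] := px.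
(* [a] is the unpaired rest, carried by point masses. The mass [x n m] is only the share at [n] of a
   multiple of [chi n m], hence the division by the weight in [c]. *)
pose a w := if L w then 0 else t 0 w - \sum_n ratio n w * x n w.
pose c (i : 'I_C * 'I_C + 'I_C) := match i with
  inl p => x p.1 p.2 / weight tau beta p.1 p.2 | inr w => a w end.
pose y (i : 'I_C * 'I_C + 'I_C) : 'rV[R]_C := match i with
  inl p => chi tau beta p.1 p.2 | inr w => point_mass w end.
have gp n m : x n m != 0 -> [/\ L n, K m & 0 < weight tau beta n m].
  by move=> /(fx n m).2 [ln km]; split=> //; exact: weight_gt0.
have tE : t = \sum_i c i *: y i.
  rewrite big_sumType /= -(pair_bigA _ (fun n m =>
    (x n m / weight tau beta n m) *: chi tau beta n m))/=.
  apply/rowP => w; rewrite mxE !summxE.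
  have -> : \sum_n (\sum_m (x n m / weight tau beta n m) *: chi tau beta n m) 0 w =
      \sum_m x w m + \sum_n ratio n w * x n w.
    transitivity (\sum_n \sum_m (x n m * (w == n)%:R + ratio n m * x n m * (w == m)%:R)).
      apply: eq_bigr => n _; rewrite summxE; apply: eq_bigr => m _.
      rewrite mxE; have [->|/gp[_ _ g0]] := eqVneq (x n m) 0.
        by rewrite !(mul0r, mulr0) addr0.
      by rewrite chiE segmentE /pairing_ratio; field; rewrite gt_eqF.
    under eq_bigr do rewrite big_split/=.
    rewrite big_split/=; congr (_ + _).
      rewrite (bigD1 w)//= eqxx [X in _ + X]big1 ?addr0.
        by apply: eq_bigr => m _; rewrite mulr1.
      move=> n; rewrite eq_sym => /negbTE ->; rewrite big1// => m _.
      by rewrite mulr0.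
    apply: eq_bigr => n _; rewrite (bigD1 w)//= eqxx mulr1 big1 ?addr0//.
    by move=> m; rewrite eq_sym => /negbTE ->; rewrite mulr0.
  have -> : \sum_i (a i *: point_mass i : 'rV[R]_C) 0 w = a w.
    rewrite (bigD1 w)//= !mxE !eqxx mulr1 big1 ?addr0// => n.
    by rewrite !mxE eq_sym => /negbTE ->; rewrite mulr0.
  rewrite /a; have [lw|lw] := boolP (L w).
    rewrite rx// addr0 [X in _ + X]big1 ?addr0// => n _.
    by rewrite (flow_notK _ _ _ fx) ?mulr0// -leNgt ltW.
  have -> : \sum_m x w m = 0 by apply: big1 => m _; exact: flow_notL lw.
  by rewrite add0r addrC subrK.
have c0 i : 0 <= c i.
  case: i => [[n m]|w] /=.
    have [->|/gp[_ _ g0]] := eqVneq (x n m) 0; first by rewrite mul0r.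
    by rewrite divr_ge0 ?(flow_ge0 _ _ _ fx)// ltW.
  by rewrite /a; case: ifPn => // lw; rewrite subr_ge0; exact: cx.
have Ay i : c i != 0 -> ((point_mass @` K1 tau beta) `|` K01 tau beta `|` [set 0]) (y i).
  case: i => [[n m]|w] /=.
    rewrite mulf_eq0 negb_or => /andP[/gp[ln km _] _].
    by left; right; exists n, m; split=> //; [exact/L0P|exact/K1P/ltW].
  rewrite /a; case: ifPn; first by rewrite eqxx.
  by rewrite -leNgt => /K1P kw _; left; left; exists w.
rewrite tE; apply: convex_hull_fin => //; first by right.
move: t1; rewrite {1}tE sum_rowC; apply: le_trans; apply: ler_sum => i _.
have [->|/Ay ci] := eqVneq (c i) 0; first by rewrite mul0r.
rewrite ler_peMr// le_eqVlt; apply/orP; left; apply/eqP/esym.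
by move: ci; case: i => [[n m]|w] _ /=; rewrite ?point_massE ?chiE sum_segment1.
Qed.

Lemma hull_L0 t : convex_hull ((point_mass @` L0 tau beta) `|` [set 0]) t ->
  (forall w, 0 <= t 0 w) /\ (forall w, t 0 w != 0 -> L w).
Proof.
move=> [k [c [y [c0 c1 yA ->]]]].
have gen i w : 0 <= y i 0 w /\ (y i 0 w != 0 -> L w).
  have [[n /L0P ln <-]|->] := yA i; rewrite !mxE ?eqxx//=.
  by case: (eqVneq w n) => [->|]; rewrite ?ler01 ?eqxx.
split=> w; rewrite summxE.
  by apply: sumr_ge0 => i _; rewrite mxE mulr_ge0//; case: (gen i w).
apply: contraR => lw; apply/eqP; apply: big1 => i _; rewrite mxE.
have [_ h] := gen i w; have [->|/h] := eqVneq (y i 0 w) 0; first by rewrite mulr0.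
by move=> l; rewrite l in lw.
Qed.

Lemma L0_hull t : (forall w, 0 <= t 0 w) -> (forall w, t 0 w != 0 -> L w) ->
  \sum_w t 0 w <= 1 -> convex_hull ((point_mass @` L0 tau beta) `|` [set 0]) t.
Proof.
move=> t0 tL t1.
have -> : t = \sum_w t 0 w *: point_mass w.
  apply/rowP => w; rewrite summxE (bigD1 w)//= !mxE !eqxx mulr1 big1 ?addr0// => n.
  by rewrite !mxE eq_sym => /negbTE ->; rewrite mulr0.
apply: convex_hull_fin => //; first by right.
by move=> w /tL/L0P lw; left; exists w.
Qed.

(** Zero at the last state, whose successor is the full queue. *)
Let next n : 'rV[R]_C := \row_w (w == n.+1 :> nat)%:R.

Let sum_next n : \sum_(w < C) (w == n.+1 :> nat)%:R + (last_state hC == n)%:R = 1 :> R.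
Proof.
have [nC|Cn] := ltnP n.+1 C.
  rewrite (bigD1 (Ordinal nC))//= eqxx big1 ?addr0; last first.
    by move=> w; rewrite -val_eqE /= => /negbTE ->.
  rewrite (_ : last_state hC == n = false) ?addr0//.
  by rewrite -val_eqE /= gtn_eqF// ltn_predRL.
rewrite big1 => [|w _].
  rewrite (_ : last_state hC == n = true) ?add0r//.
  have nC : n.+1 = C by apply/eqP; rewrite eqn_leq ltn_ord Cn.
  by apply/eqP/val_inj; rewrite /= -[RHS]/(n.+1.-1) nC.
by rewrite ltn_eqF// (leq_trans (ltn_ord w)).
Qed.

Lemma optimal_pairing_tight t0 t1 x m : lp_optimal hC lam tau beta t0 t1 ->
  t0 != 0 -> pairing t1 x -> K m -> \sum_n ratio n m * x n m = t1 0 m.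
Proof.
move=> [feas opt] t0n px km; have [h1 h0 rec tot] := feas.
have [t00 t0L] := hull_L0 _ h0; have [fx rx cx] := px.
have lm : ~~ L m by rewrite -leNgt ltW.
apply/eqP; rewrite eq_le cx//= leNgt; apply/negP => slack.
have [n t0n0] : exists n, t0 0 n != 0.
  apply/existsP; apply: contraT; rewrite negb_exists => /forallP t0E.
  move/eqP: t0n; case; apply/rowP => w; rewrite [RHS]mxE.
  by have := t0E w; rewrite negbK => /eqP.
have ln := t0L _ t0n0.
have t0np : 0 < t0 0 n by rewrite lt_neqAle eq_sym t0n0 t00.
have rp : 0 < ratio n m by exact: ratio_gt0.
(* The largest mass that [t0] has at [n] and that the slack at [m] can be paired with. *)
pose e := Num.min (t0 0 n) ((t1 0 m - \sum_i ratio i m * x i m) / ratio n m).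
have e0 : 0 < e by rewrite lt_min t0np divr_gt0// subr_gt0.
have et0 : e <= t0 0 n by rewrite ge_min lexx.
have em : ratio n m * e <= t1 0 m - \sum_i ratio i m * x i m.
  by rewrite mulrC -ler_pdivlMr// ge_min lexx orbT.
(* Mass [e] moves from [t0] to [t1] at state [n]; the flow out of [n] then grows by
   [lam * e], which is left unpaired in state [n.+1] (or in the full queue). *)
pose N := 1 + lam * e.
have N0 : 0 < N by rewrite addr_gt0// mulr_gt0.
pose s0 := N^-1 *: (t0 - e *: point_mass n + (lam * e) *: next n).
pose s1 := N^-1 *: (t1 + e *: point_mass n).
have ps1 : pairing s1 (fun i j => N^-1 * (x i j + single n m e i j)).
  apply: pairingZ; first by rewrite invr_ge0 ltW.
  split=> [i j|i li|j lj].
  - have fs := flow_single _ _ _ ln km (ltW e0).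
    have [xi0 hi] := fx i j; have [si0 hsi] := fs i j.
    split; first exact: addr_ge0.
    by have [->|/hi//] := eqVneq (x i j) 0; rewrite add0r; exact: hsi.
  - by rewrite big_split/= sum_single_row -rx// !mxE.
  - under eq_bigr do rewrite mulrDr.
    rewrite big_split/= sum_single_col !mxE /=.
    have jn : (j == n) = false by apply/negbTE/eqP => jn; move: lj; rewrite jn ln.
    rewrite jn ?andbF mulr0 addr0; have [->|_] := eqVneq j m; first by rewrite mulr1; lra.
    by rewrite mulr0 addr0 cx.
have s1E w : s1 0 w = (t1 0 w + e * (w == n)%:R) / N.
  by rewrite !mxE eqxx mulrC.
have s0E w : s0 0 w = (t0 0 w - e * (w == n)%:R + lam * e * (w == n.+1 :> nat)%:R) / N.
  by rewrite !mxE eqxx mulrC.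
have sum1 : \sum_w (w == n)%:R = 1 :> R.
  by rewrite (bigD1 n)//= eqxx big1 ?addr0// => i /negbTE ->.
have sums1 : \sum_w s1 0 w = (\sum_w t1 0 w + e) / N.
  under eq_bigr do rewrite s1E.
  by rewrite -mulr_suml big_split/= -mulr_sumr sum1 mulr1.
have sums0 : \sum_w s0 0 w =
    (\sum_w t0 0 w - e + lam * e * \sum_(w < C) (w == n.+1 :> nat)%:R) / N.
  under eq_bigr do rewrite s0E.
  by rewrite -mulr_suml big_split/= sumrB -!mulr_sumr sum1 mulr1.
have s10 w : 0 <= s1 0 w by exact: pairing_ge0 ps1.
have s00 w : 0 <= s0 0 w.
  rewrite s0E divr_ge0 ?(ltW N0)// addr_ge0 ?mulr_ge0 ?(ltW e0) ?(ltW lam_gt0)//.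
  by rewrite subr_ge0; have [->|_] := eqVneq w n; rewrite ?mulr1// mulr0.
(* The state [n.+1] is again a leaving state, as utility decreases, so [s0] may hold the additional
   mass there. *)
have s0L w : s0 0 w != 0 -> L w.
  apply: contraR => lw; rewrite s0E.
  have t0w : t0 0 w = 0 by apply/eqP; apply: contraT => /t0L; rewrite (negbTE lw).
  have [wn|_] := eqVneq w n; first by move: lw; rewrite wn ln.
  have [wn|_] := eqVneq (w : nat) n.+1; last by rewrite t0w !mulr0 subr0 addr0 mul0r.
  by move: lw; rewrite (lt_trans _ ln)//; apply: utility_decr => //; rewrite wn.
have stot : \sum_w s0 0 w + \sum_w s1 0 w + lam * s1 0 (last_state hC) = 1.
  rewrite sums0 sums1 s1E.
  rewrite mulrA -!mulrDl; apply/eqP; rewrite -subr_eq0 -[X in _ - X](divff (lt0r_neq0 N0)).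
  rewrite -mulrBl mulf_eq0; apply/orP; left; rewrite subr_eq0; apply/eqP.
  transitivity (\sum_w t0 0 w + \sum_w t1 0 w + lam * t1 0 (last_state hC) +
    lam * e * (\sum_(w < C) (w == n.+1 :> nat)%:R + (last_state hC == n)%:R)).
    by ring.
  by rewrite tot sum_next mulr1.
have srec (w w' : 'I_C) : w' = w.+1 :> nat -> s0 0 w' + s1 0 w' = lam * s1 0 w.
  move=> ww'; rewrite s0E !s1E ww' eqSS (_ : (val w == n) = (w == n))//.
  have := rec _ _ ww' => h.
  rewrite -mulrDl mulrA; congr (_ / _).
  by move: h; lra.
have s_ge0 : 0 <= lam * s1 0 (last_state hC) by rewrite mulr_ge0// ltW.
have S0 : 0 <= \sum_w s0 0 w by exact: sumr_ge0.
have S1 : 0 <= \sum_w s1 0 w by exact: sumr_ge0.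
have sfeas : lp_feasible hC lam tau beta s0 s1.
  split=> //; first by apply: pairing_hull ps1 _; lra.
  by apply: L0_hull => //; lra.
(* Optimality of throughput [T] against [(T + e) / N] means [1 <= lam * T]. *)
have := opt _ _ sfeas; rewrite /lp_objective sums1 ler_pdivrMr// /N mulrDr mulr1 lerD2l.
rewrite mulrA -[X in X <= _]mul1r ler_pM2r//.
have t10 w : 0 <= t1 0 w by exact: pairing_ge0 px.
by rewrite leNgt mulrC (throughput_lt1 hC lam t0 t1 t00 t10 rec tot).
Qed.

End program.

(** * Signaling schemes *)

Lemma sum_option {V : nmodType} {I : finType} (P : pred (option I)) (F : option I -> V) :
  \sum_(s | P s) F s = (if P None then F None else 0) + \sum_(i | P (Some i)) F (Some i).
Proof.
rewrite big_mkcond (bigD1 None)//=; congr (_ + _).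
rewrite (reindex_omap Some id) => [|[]//].
rewrite [RHS]big_mkcond; apply: eq_bigl => i.
by rewrite eqxx.
Qed.

(** The flow from [i] to [j] equals that from [j] to [i]: upward moves on one side match downward
    moves on the other. *)
Lemma detailed_balance_stationary {R : realType} {C : nat} (lam : R)
    (q : 'I_C -> R) (p : 'I_C.+1 -> R) :
  (forall i, 0 <= p i) -> \sum_i p i = 1 ->
  (forall w, p (before w) * (lam * q w) = p (after w)) -> stationary lam q p.
Proof.
move=> p0 p1 bal; split=> // j; rewrite mulr_sumr; apply: eq_bigr => i _.
rewrite /queue_rate !mulrDr [RHS]addrC !mulr_sumr; congr (_ + _).
  rewrite (eq_bigl (fun w : 'I_C => (j == after w) && (i == before w))).
    by apply: eq_bigr => w /andP[/eqP -> /eqP ->]; rewrite bal mulr1.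
  by move=> w; rewrite andbC.
rewrite (eq_bigl (fun w : 'I_C => (j == before w) && (i == after w))).
  by apply: eq_bigr => w /andP[/eqP -> /eqP ->]; rewrite bal mulr1.
by move=> w; rewrite andbC.
Qed.

(** The joint law of state and signal is prescribed, and conditioning on the state gives [sigma].
    The constraints of the program are the balance equations and the normalisation of [p]. *)
Lemma scheme_of_decomposition {R : realType} {C J : nat} (hC : (0 < C)%N) (lam : R)
    (t0 t1 : 'rV[R]_C) (mass : 'I_J -> R) (belief : 'I_J -> 'rV[R]_C) :
  0 <= lam ->
  (forall w w' : 'I_C, w' = w.+1 :> nat -> t0 0 w' + t1 0 w' = lam * t1 0 w) ->
  \sum_w t0 0 w + \sum_w t1 0 w + lam * t1 0 (last_state hC) = 1 ->
  (forall w, 0 <= t0 0 w) -> 0 < \sum_w t0 0 w ->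
  (forall j, 0 < mass j) -> (forall j, simplex (belief j)) ->
  t1 = \sum_j mass j *: belief j ->
  exists (sigma : 'I_C -> signals J -> R) (p : 'I_C.+1 -> R),
    [/\ is_signaling sigma, stationary lam (action_prob sigma follow true) p,
        forall s, 0 < signal_prob sigma p s,
        induced_joint sigma follow p false = t0 /\
        induced_joint sigma follow p true = t1
      & (forall j, induced_belief sigma p (Join j) = belief j) /\
        induced_belief sigma p Leave = (\sum_w t0 0 w)^-1 *: t0].
Proof.
move=> lam0 rec tot t00 t0p mass0 beliefs t1E.
pose tot_w w := t0 0 w + t1 0 w.
pose joint w (s : signals J) :=
  if s is Some j then mass j * belief j 0 w else t0 0 w.
(* States that are never reached are sent [Leave]. *)
pose sigma w (s : signals J) : R :=
  if tot_w w == 0 then (s == None)%:R else joint w s / tot_w w.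
(* The default is the mass of the full queue, the one length that [insub] rejects. *)
pose p (i : 'I_C.+1) : R := oapp tot_w (lam * t1 0 (last_state hC)) (insub (i : nat)).
have joint0 w s : 0 <= joint w s.
  by case: s => [j|] /=; rewrite ?t00// mulr_ge0 ?(ltW (mass0 j))// (beliefs j).1.
have t1w w : t1 0 w = \sum_j mass j * belief j 0 w.
  by rewrite t1E summxE; apply: eq_bigr => j _; rewrite mxE.
have jointE w : \sum_s joint w s = tot_w w.
  by rewrite (sum_option predT)/= /tot_w t1w.
have tot0 w : 0 <= tot_w w by rewrite -jointE; apply: sumr_ge0 => s _; exact: joint0.
have sigmaE w s : tot_w w * sigma w s = joint w s.
  rewrite /sigma; case: eqVneq => [tw|tw]; last by rewrite mulrC divfK.
  rewrite tw mul0r; apply/esym.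
  by apply: (@psumr_eq0P _ _ predT (joint w)) => //; rewrite jointE.
have pb w : p (before w) = tot_w w by rewrite /p /= valK.
have t10 w : 0 <= t1 0 w.
  by rewrite t1w; apply: sumr_ge0 => j _; exact: (joint0 w (Some j)).
have pa w : p (after w) = lam * t1 0 w.
  rewrite /p; case: insubP => [w' _ w'E|].
    exact: (rec w w' (etrans w'E (lift0 w))).
  rewrite -leqNgt lift0 => Cw; congr (_ * t1 0 _); apply: val_inj => /=.
  have wC : w.+1 = C by apply/eqP; rewrite eqn_leq ltn_ord Cw.
  by rewrite -[RHS]/(w.+1.-1) wC.
have joint_true w : \sum_(s | follow s == true) joint w s = t1 0 w.
  by rewrite sum_option /= add0r t1w.
have joint_false w : \sum_(s | follow s == false) joint w s = t0 0 w.
  by rewrite sum_option /= big_pred0 ?addr0.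
have signalE s : signal_prob sigma p s = \sum_w joint w s.
  by apply: eq_bigr => w _; rewrite pb sigmaE.
have massE j : \sum_w joint w (Some j) = mass j.
  by rewrite /joint -mulr_sumr (beliefs j).2 mulr1.
exists sigma, p; split.
- split=> [w s|w].
    by rewrite /sigma; case: ifP => _; [exact: ler0n|rewrite divr_ge0].
  rewrite /sigma; case: eqVneq => [_|tw].
    by rewrite (bigD1 None)//= big1 ?addr0// => s /negbTE ->.
  by rewrite -mulr_suml jointE divff.
- apply: detailed_balance_stationary => [i||w].
  + by rewrite /p; case: insub => [w|]/=; rewrite ?tot0// mulr_ge0.
  + rewrite big_ord_recr /= -[RHS]tot -big_split/=; congr (_ + _).
      by apply: eq_bigr => w _; exact: pb.
    by rewrite /p insubN//= -leqNgt.
  + rewrite pb pa mulrCA; congr (_ * _); rewrite /action_prob mulr_sumr -joint_true.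
    by apply: eq_bigr => s _; exact: sigmaE.
- case=> [j|]; rewrite signalE; last exact: t0p.
  by rewrite massE.
- split; apply/rowP => w; rewrite mxE pb /action_prob mulr_sumr.
    by under eq_bigr do rewrite sigmaE; rewrite joint_false.
  by under eq_bigr do rewrite sigmaE; rewrite joint_true.
- split=> [j|]; apply/rowP => w; rewrite mxE pb sigmaE signalE.
    by rewrite massE /joint mulrAC divff ?mul1r// gt_eqF.
  by rewrite mxE mulrC.
Qed.

(** * Decomposition into nested pairs of zero utility *)

Section pairs.
Context {R : realType} {C : nat}.
Variables (tau beta : R).
Hypothesis beta_ge0 : 0 <= beta.
Implicit Types (p q : 'I_C * 'I_C) (n m w : 'I_C).

Local Notation u n := (utility tau beta n).
Local Notation L n := (u n < 0).
Local Notation K n := (0 < u n).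
Local Notation weight := (weight tau beta).
Local Notation ratio := (pairing_ratio tau beta).
Local Notation wait := (@wait R C).

Definition pair_weight p : R := if p.1 == p.2 then 1 else weight p.1 p.2.
Definition pair_belief p : 'rV[R]_C := segment (pair_weight p) p.1 p.2.

(* A pair [(w, w)] stands for the point mass at a state of zero utility. *)
Definition zero_pair p : Prop :=
  (p.1 = p.2 /\ u p.1 = 0) \/ (L p.1 /\ K p.2).

Lemma zero_pair_le p : zero_pair p -> (p.2 <= p.1)%N.
Proof.
case=> [[-> _]|[lp kp]]; first exact: leqnn.
by apply: ltnW; exact: utility_sign_lt beta_ge0 _ _ lp (ltW kp).
Qed.

Lemma L_neq_K n m : L n -> K m -> (n == m) = false.
Proof. by move=> ln km; apply/negbTE/eqP => nm; move: (lt_trans ln km); rewrite nm ltxx. Qed.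

Lemma zero_pair_excess p : zero_pair p ->
  [/\ 0 <= pair_weight p <= 1,
      excess2 tau beta (pair_weight p) (wait p.1) (1 - pair_weight p) (wait p.2) = 0 &
      excess1 tau beta (wait p.1) < 0 \/
      (excess1 tau beta (wait p.1) <= 0 /\ wait p.2 = wait p.1)].
Proof.
rewrite /pair_weight; case=> [[p12 u0]|[lp kp]].
  rewrite -p12 eqxx ler01 lexx excess2_diag; last by rewrite addrC subrK.
  by rewrite -!utilityE// u0; split=> //; right; rewrite lexx.
have [/andP[g0 g1] e0] := weight_spec _ _ beta_ge0 _ _ lp (ltW kp).
rewrite (L_neq_K _ _ lp kp) g0 (ltW g1) e0; split=> //; left.
by rewrite -utilityE.
Qed.

Lemma rho_pair_belief p : zero_pair p -> rho tau beta (pair_belief p) = 0.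
Proof. by move=> /zero_pair_excess[g01 e0 _]; rewrite rho_segment. Qed.

Lemma nested_pair_moments p q : zero_pair p -> zero_pair q ->
  (p.2 <= q.2)%N -> (q.1 <= p.1)%N ->
  mean_wait (pair_belief p) <= mean_wait (pair_belief q) /\
  var_wait (pair_belief q) <= var_wait (pair_belief p).
Proof.
move=> zp zq pq2 pq1; have [gp ep _] := zero_pair_excess _ zp.
have [gq eq xq] := zero_pair_excess _ zq.
rewrite (mean_wait_segment _ _ _ gp) (mean_wait_segment _ _ _ gq).
rewrite (var_wait_segment _ _ _ gp) (var_wait_segment _ _ _ gq).
exact: (nested_moments tau beta beta_ge0 _ _ _ _ _ _ (wait_ge0 _) (wait_le _ _ pq2)
  (wait_le _ _ (zero_pair_le _ zq)) (wait_le _ _ pq1) gp gq ep eq xq).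
Qed.

Variables (t : 'rV[R]_C) (x : 'I_C -> 'I_C -> R).
Hypothesis tx : pairing tau beta t x.
Hypothesis tight : forall m, K m -> \sum_n ratio n m * x n m = t 0 m.

Definition pair_mass p : R :=
  if p.1 == p.2 then (if u p.1 == 0 then t 0 p.1 else 0)
  else x p.1 p.2 / weight p.1 p.2.

Lemma pair_massP p : pair_mass p != 0 ->
  [/\ 0 < pair_mass p, zero_pair p & p.1 != p.2 -> x p.1 p.2 != 0].
Proof.
have [fx _ _] := tx; rewrite /pair_mass; have [p12|p12] := eqVneq p.1 p.2.
  case: ifP => [/eqP u0 tp|_ /eqP//]; split=> //; last by left.
  by rewrite lt_neqAle eq_sym tp (pairing_ge0 _ _ beta_ge0 _ _ _ tx).
rewrite mulf_eq0 negb_or => /andP[xp _].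
have [xp0 /(_ xp) [lp kp]] := fx p.1 p.2; split=> //; last by right.
by rewrite divr_gt0 ?weight_gt0// lt_neqAle eq_sym xp.
Qed.

(** Leaving states are covered by the rows of [x], states of positive utility by its columns thanks
    to [tight], and a state of zero utility by the diagonal. *)
Lemma pairing_decomposition : t = \sum_p pair_mass p *: pair_belief p.
Proof.
have [fx rx _] := tx.
apply/rowP => w; rewrite summxE.
transitivity (\sum_p (x p.1 p.2 * (w == p.1)%:R +
    ratio p.1 p.2 * x p.1 p.2 * (w == p.2)%:R +
    (if p.1 == p.2 then (if u p.1 == 0 then t 0 p.1 else 0) * (w == p.1)%:R else 0))).
  rewrite -(pair_bigA _ (fun n m => x n m * (w == n)%:R + ratio n m * x n m * (w == m)%:R +
    (if n == m then (if u n == 0 then t 0 n else 0) * (w == n)%:R else 0)))/=.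
  under eq_bigr do rewrite !big_split/=.
  rewrite !big_split/=.
  have -> : \sum_i \sum_j x i j * (w == i)%:R = \sum_j x w j.
    rewrite (bigD1 w)//= eqxx [X in _ + X]big1 ?addr0.
      by apply: eq_bigr => m _; rewrite mulr1.
    move=> n; rewrite eq_sym => /negbTE ->; rewrite big1// => m _.
    by rewrite mulr0.
  have -> : \sum_i \sum_j ratio i j * x i j * (w == j)%:R = \sum_n ratio n w * x n w.
    apply: eq_bigr => n _; rewrite (bigD1 w)//= eqxx mulr1 big1 ?addr0//.
    by move=> m; rewrite eq_sym => /negbTE ->; rewrite mulr0.
  have -> : \sum_i \sum_j (if i == j then (if u i == 0 then t 0 i else 0) * (w == i)%:R else 0)
      = if u w == 0 then t 0 w else 0.
    rewrite (bigD1 w)//= [X in _ + X]big1 ?addr0.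
      by rewrite (bigD1 w)//= eqxx mulr1 big1 ?addr0// => m; rewrite eq_sym => /negbTE ->.
    move=> n; rewrite eq_sym => /negbTE wn; rewrite big1// => m _.
    by rewrite wn mulr0; case: ifP.
  have noL : ~~ L w -> \sum_j x w j = 0.
    by move=> lw; apply: big1 => j _; exact: flow_notL fx lw.
  have noK : ~~ K w -> \sum_n ratio n w * x n w = 0.
    by move=> kw; apply: big1 => j _; rewrite (flow_notK _ _ _ _ _ fx kw) mulr0.
  have [lw|lw] := boolP (L w).
    have -> : (u w == 0) = false by rewrite lt_eqF.
    by rewrite noK ?addr0 ?rx// -leNgt ltW.
  rewrite noL// add0r; have [kw|kw] := boolP (K w).
    have -> : (u w == 0) = false by rewrite gt_eqF.
    by rewrite addr0 tight.
  have -> : (u w == 0) = true by rewrite eq_le !leNgt lw kw.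
  by rewrite noK// add0r.
apply: eq_bigr => -[n m] _; rewrite mxE /pair_mass /pair_belief /pair_weight /=.
have [->|nm] := eqVneq n m.
  have x0 : x m m = 0.
    apply/eqP; apply: contraT => /(fx m m).2 [l k].
    by move: (lt_trans l k); rewrite ltxx.
  by rewrite x0 mulr0 !mul0r !add0r segmentE subrr mul0r addr0 mul1r.
rewrite addr0 segmentE; have [->|xn] := eqVneq (x n m) 0.
  by rewrite !(mul0r, mulr0) addr0.
have [l k] := (fx n m).2 xn.
have w0 : weight n m != 0 by rewrite gt_eqF// weight_gt0.
by rewrite /pairing_ratio; field.
Qed.

Hypothesis nested : forall k, nested_row x k.

(** Off the diagonal this is [nested]. As utility strictly decreases, a zero-utility state is unique
    and separates joining from leaving states, so its pair is innermost. *)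
Lemma pair_mass_noncrossing p q : pair_mass p != 0 -> pair_mass q != 0 ->
  (p.1 < q.1)%N -> (q.2 <= p.2)%N.
Proof.
move=> /pair_massP[_ zp xp] /pair_massP[_ zq xq] pq1; rewrite leqNgt; apply/negP => pq2.
case: zp => [[p12 up]|[lp kp]].
  case: zq => [[q12 uq]|[lq kq]].
    by move: (utility_decr tau beta beta_ge0 _ _ pq1); rewrite up uq ltxx.
  rewrite p12 in up; have := utility_decr tau beta beta_ge0 _ _ pq2.
  by rewrite up => /(lt_trans kq); rewrite ltxx.
case: zq => [[q12 uq]|[lq kq]].
  have := utility_decr tau beta beta_ge0 _ _ pq1.
  by rewrite uq => /(lt_trans lp); rewrite ltxx.
apply: (nested q.1 p.1 p.2 q.2 pq1 pq2).
- by apply: xp; rewrite L_neq_K.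
- by apply: xq; rewrite L_neq_K.
Qed.

(* Strictly increasing along chains of nested pairs. *)
Definition pair_rank p : nat := (p.2 + (C.-1 - p.1))%N.

Lemma pair_rank_nested p q : pair_mass p != 0 -> pair_mass q != 0 ->
  (pair_rank p <= pair_rank q)%N -> (p.2 <= q.2)%N /\ (q.1 <= p.1)%N.
Proof.
move=> mp mq; have := pair_mass_noncrossing _ _ mp mq.
have := pair_mass_noncrossing _ _ mq mp; rewrite /pair_rank.
have := ltn_ord p.1; have := ltn_ord q.1; move: (C) p.1 p.2 q.1 q.2 {mp mq}.
by move=> ? [? ?] [? ?] [? ?] [? ?] /=; clear; lia.
Qed.

Lemma pair_rank_lt p : pair_mass p != 0 -> (pair_rank p < C)%N.
Proof.
move=> /pair_massP[_ /zero_pair_le + _]; rewrite /pair_rank.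
by have := ltn_ord p.1; move: (p.1 : nat) (p.2 : nat); clear; lia.
Qed.

(** The pairs of nonzero mass are sorted by [pair_rank]. Pairs of equal rank are nested both ways,
    hence equal, and ranks are below [C]: this bounds [J]. *)
Lemma nested_enumeration : exists (J : nat) (pr : 'I_J -> 'I_C * 'I_C),
  [/\ (J <= C)%N, forall j, pair_mass (pr j) != 0,
      forall i j : 'I_J, (i <= j)%N ->
        ((pr i).2 <= (pr j).2)%N /\ ((pr j).1 <= (pr i).1)%N
    & t = \sum_j pair_mass (pr j) *: pair_belief (pr j)].
Proof.
pose D := [pred p | pair_mass p != 0]; pose e := [rel p q | pair_rank p <= pair_rank q]%N.
pose s := sort e (enum D).
have sD p : (p \in s) = (pair_mass p != 0) by rewrite mem_sort mem_enum /D inE.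
have us : uniq s by rewrite sort_uniq enum_uniq.
have ss : sorted e s by apply: sort_sorted => p q; exact: leq_total.
pose pr j := tnth (in_tuple s) j.
have mpr j : pair_mass (pr j) != 0 by rewrite -sD mem_tnth.
exists (size s), pr; split=> // [|i j ij|].
- rewrite -(size_map pair_rank) -[leqRHS](size_iota 0); apply: uniq_leq_size.
    rewrite map_inj_in_uniq// => p q; rewrite !sD => mp mq pqr.
    have [h1 h2] := pair_rank_nested _ _ mp mq (eq_leq pqr).
    have [h3 h4] := pair_rank_nested _ _ mq mp (eq_leq (esym pqr)).
    rewrite [p]surjective_pairing [q]surjective_pairing; congr pair.
      by apply/val_inj/eqP; rewrite /= eqn_leq h4 h2.
    by apply/val_inj/eqP; rewrite /= eqn_leq h1 h3.
  move=> k /mapP[p]; rewrite sD => mp ->.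
  by rewrite mem_iota add0n pair_rank_lt.
- apply: pair_rank_nested => //.
  have p0 : 'I_C * 'I_C := pr i.
  rewrite /pr !(tnth_nth p0) /=.
  have tr : transitive e by move=> a b c; exact: leq_trans.
  have re : reflexive e by move=> a; exact: leqnn.
  exact: (sorted_leq_nth tr re p0 ss _ _ (ltn_ord i) (ltn_ord j) ij).
- rewrite {1}pairing_decomposition.
  rewrite -(big_tnth _ _ s predT (fun p => pair_mass p *: pair_belief p)).
  rewrite [RHS](perm_big (enum D)) /=; last by apply/permPl; exact: perm_sort.
  rewrite big_enum [LHS]big_mkcond [RHS]big_mkcond /=; apply: eq_bigr => p _.
  by rewrite /D inE; case: eqVneq => //= ->; rewrite scale0r.
Qed.

End pairs.

(** * Assembly of the sandwich-structured scheme *)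

Lemma sandwichP {C J : nat} (w0 w1 : 'I_J -> 'I_C) :
  (forall i j : 'I_J, (i <= j)%N -> (w1 i <= w1 j)%N /\ (w0 j <= w0 i)%N) ->
  (forall j, (w1 j <= w0 j)%N) -> sandwich w0 w1.
Proof.
move=> mono w10; have ord_sorted : pairwise (fun i j : 'I_J => (i <= j)%N) (enum 'I_J).
  have : sorted leq [seq val i | i <- enum 'I_J] by rewrite val_enum_ord iota_sorted.
  by rewrite (sorted_pairwise leq_trans) pairwise_map.
rewrite /sandwich (sorted_pairwise leq_trans) pairwise_cat; apply/and3P; split.
- apply/allrelP => a b /mapP[i _ ->]; rewrite mem_rev => /mapP[j _ ->].
  have [ij|ji] := leqP i j.
    by apply: leq_trans (w10 j); case: (mono _ _ ij).
  by apply: (leq_trans (w10 i)); case: (mono _ _ (ltnW ji)).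
- rewrite pairwise_map; apply: sub_pairwise ord_sorted => i j /= ij.
  by case: (mono _ _ ij).
rewrite -(sorted_pairwise leq_trans) rev_sorted sorted_pairwise; last first.
  by move=> a b c ba ac; exact: leq_trans ac ba.
rewrite pairwise_map; apply: sub_pairwise ord_sorted => i j /= ij.
by case: (mono _ _ ij).
Qed.

Theorem proposition4 (R : realType) (C : nat) (hC : (0 < C)%N)
    (lam tau beta : R) (hlam : 0 < lam) (htau : 0 < tau) (hbeta : 0 <= beta)
    (t0 t1 : 'rV[R]_C) (ht : lp_optimal hC lam tau beta t0 t1)
    (ht0 : t0 != 0) :
  exists J : nat, (J <= #|'I_C|)%N /\
  exists (sigma : 'I_C -> signals J -> R) (p : 'I_C.+1 -> R),
    optimal_scheme hC lam tau beta sigma follow p /\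
    let mu := fun j : 'I_J => induced_belief sigma p (Join j) in
    [/\ forall j, join_optimal tau beta (mu j),
        leave_optimal tau beta (induced_belief sigma p Leave),
        forall j, rho tau beta (mu j) = 0,
        exists w0 w1 : 'I_J -> 'I_C,
          (forall j,
             (exists w, [/\ (K1 tau beta `&` K0 tau beta) w, mu j = point_mass w,
                            w0 j = w & w1 j = w]) \/
             [/\ L0 tau beta (w0 j), K1 tau beta (w1 j)
               & forall w, 0 < mu j 0 w -> w = w0 j \/ w = w1 j])
          /\ sandwich w0 w1
      & forall i j : 'I_J, j = i.+1 :> nat ->
          mean_wait (mu i) <= mean_wait (mu j) /\
          var_wait (mu j) <= var_wait (mu i)].
Proof.
have [[h1 h0 rec tot] _] := ht.
have [t00 t0L] := hull_L0 _ _ _ h0.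
have [[x1 px1] _] := hull_pairing _ _ hbeta _ h1.
have [fx1 rx1 cx1] := px1.
have [x [[fx rx cx] nested]] := nested_flow_exists _ _ _
  (fun n m ln km => ratio_gt0 tau beta hbeta n m ln km)
  (fun n1 n2 m1 m2 m12 n12 => ratio_submodular tau beta hbeta n1 n2 m1 m2 m12 n12) _ fx1.
(* Refinement keeps the row sums and does not raise the column loads, so the nested flow still pairs
   the same [t1]. *)
have px : pairing tau beta t1 x.
  split=> // [n ln|m lm]; first by rewrite rx rx1.
  exact: le_trans (cx m) (cx1 m lm).
have tight m : 0 < utility tau beta m -> \sum_n pairing_ratio tau beta n m * x n m = t1 0 m.
  exact: (optimal_pairing_tight hC lam tau beta hlam hbeta _ _ _ _ ht ht0 px).
have [J [pr [JC mpr mono t1E]]] := nested_enumeration _ _ hbeta _ _ px tight nested.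
have zpr j : zero_pair tau beta (pr j) by case: (pair_massP _ _ hbeta _ _ px _ (mpr j)).
have t0p : 0 < \sum_w t0 0 w.
  rewrite lt_neqAle sumr_ge0 ?andbT//; apply/eqP => /esym /(psumr_eq0P (fun w _ => t00 w)) t0E.
  by move/eqP: ht0; apply; apply/rowP => w; rewrite t0E// mxE.
have [|j|j|sigma [p [sig stat sp [jf jt] [bj bl]]]] :=
  @scheme_of_decomposition R C J hC lam t0 t1 (fun j => pair_mass tau beta t1 x (pr j))
    (fun j => pair_belief tau beta (pr j)) _ rec tot t00 t0p _ _ t1E.
- exact: ltW.
- by case: (pair_massP _ _ hbeta _ _ px _ (mpr j)).
- by apply: segment_simplex; case: (zero_pair_excess _ _ hbeta _ (zpr j)).
have rho_join j : rho tau beta (induced_belief sigma p (Join j)) = 0.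
  by rewrite bj; exact: rho_pair_belief.
have rho_leave : leave_optimal tau beta (induced_belief sigma p Leave).
  rewrite bl; apply: rho_le0_on_L0 => //; first split=> [w|].
  - by rewrite mxE mulr_ge0// invr_ge0 ltW.
  - by under eq_bigr do rewrite mxE; rewrite -mulr_sumr mulVf// gt_eqF.
  - by move=> w; rewrite mxE mulf_eq0 negb_or => /andP[_ /t0L].
exists J; split; first by rewrite card_ord.
exists sigma, p; split.
  split=> //; last by rewrite jf jt.
  by case=> [j|] //=; rewrite /join_optimal rho_join.
move=> mu; split=> //.
- by move=> j; rewrite /join_optimal rho_join.
- exists (fun j => (pr j).1), (fun j => (pr j).2); split; last first.
    by apply: sandwichP => // j; exact: zero_pair_le (zpr j).
  move=> j; case: (zpr j) => [[p12 u0]|[lp kp]].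
    left; exists (pr j).1; split=> //.
      by rewrite /K1 /K0 /= rho_point_mass u0 lexx.
    by rewrite /mu bj /pair_belief -p12 segment_diag.
  right; split; [exact/L0P|exact/K1P/ltW|move=> w].
  rewrite /mu bj segmentE.
  have [->|_] := eqVneq w (pr j).1; first by left.
  have [->|_] := eqVneq w (pr j).2; first by right.
  by rewrite !mulr0 addr0 ltxx.
- move=> i j ij; rewrite /mu !bj.
  have [h2 h1'] := mono i j (ltnW (eq_leq (esym ij))).
  exact: nested_pair_moments.
Qed.
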